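(* Let $M$ be a metric space with $\operatorname{dens} M\leq 2^{\omega}$ such that there is an injective bounded linear operator $T:\mathcal F(M)\to c_0(2^{\omega})$. Then $(\operatorname{Lip}_0(M),w^* )$ is separable. In particular, if $M$ is a metric space with $\operatorname{dens} M\leq 2^{\omega}$ such that $\mathcal F(M)$ has a Markushevich basis (which is true e.g. whenever $M$ is a Banach space with a projectional skeleton), then $(\operatorname{Lip}_0(M),w^* )$ is separable.
   Context: $M$ has a distinguished base point $0$ (the origin if $M$ is a Banach space). $\operatorname{Lip}_0(M)$ is the Banach space of real-valued Lipschitz functions $f$ on $M$ with $f(0)=0$, normed by the best Lipschitz constant. For $x\in M$, $\delta(x)\in \operatorname{Lip}_0(M)^*$ is evaluation at $x$; $\mathcal F(M)=\overline{\operatorname{span}}\{\delta(x):x\in M\}\subset \operatorname{Lip}_0(M)^*$ is the Lipschitz-free space, and $\mathcal F(M)^*=\operatorname{Lip}_0(M)$ isometrically. The $w^*$ topology on $\operatorname{Lip}_0(M)$ is the one induced by the predual $\mathcal F(M)$. $\operatorname{dens}$ is the smallest cardinality of a dense subset; $2^\omega$ is the cardinality of the continuum. A Markushevich basis of a Banach space $X$ is a biorthogonal system $(x_i,x_i^* )_{i\in I}\subset X\times X^*$ such that $\overline{\operatorname{span}}\{x_i\}=X$ and $\{x_i^*\}$ separates the points of $X$. A projectional skeleton on a Banach space $X$ is a family $(P_s)_{s\in\Gamma}$ of bounded linear projections on $X$ indexed by an up-directed partially ordered set $\Gamma$ in which every increasing sequence has a supremum, such that: each $P_sX$ is separable and $X=\bigcup_{s\in\Gamma}P_sX$;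 $s\le t$ implies $P_s=P_sP_t=P_tP_s$; and if $s_1<s_2<\cdots$ in $\Gamma$ and $t=\sup_n s_n$, then $P_tX=\overline{\bigcup_n P_{s_n}X}$. *)

(* Defs.v *)
From HB Require Import structures.
From mathcomp Require Import all_boot all_order all_algebra.
From mathcomp Require Import all_classical all_reals all_analysis.
From mathcomp Require Import ring.

Set Implicit Arguments.
Unset Strict Implicit.
Unset Printing Implicit Defensive.

Import Order.TTheory GRing.Theory Num.Theory.
Import numFieldNormedType.Exports.

Local Open Scope classical_set_scope.
Local Open Scope ring_scope.

(* Lipschitz, dual and supremum norms all are, for a family of linear forms  *)
(* L i and weights w i, the least k >= 0 with |L i f| <= k * w i for all i.  *)
Section least_const.
Context (R : realType) (I : Type).
Implicit Types (p w : I -> R) (k : R).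

Definition least_const p w : R :=
  inf [set k | 0 <= k /\ forall i, p i <= k * w i].

Lemma least_const_ge0 p w : 0 <= least_const p w.
Proof.
rewrite /least_const; set A := [set _ | _].
have [->|/set0P A0] := eqVneq A set0; first by rewrite inf0.
by apply: lb_le_inf => // k [].
Qed.

Lemma least_const_le p w k :
  0 <= k -> (forall i, p i <= k * w i) -> least_const p w <= k.
Proof. by move=> k0 kP; apply: ge_inf; [exists 0 => ? []|]. Qed.

Lemma least_constP p w : (forall i, 0 <= w i) ->
  (exists k, forall i, p i <= k * w i) ->
  forall i, p i <= least_const p w * w i.
Proof.
move=> w0 [k0 k0P] i.
have A0 : [set k | 0 <= k /\ forall i, p i <= k * w i] !=set0.
  exists (Num.max 0 k0); split; first by rewrite le_max lexx.
  by move=> j; rewrite (le_trans (k0P j))// ler_wpM2r// le_max lexx orbT.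
have [wi0|wi0] := eqVneq (w i) 0.
  by case: A0 => k [_ /(_ i)]; rewrite wi0 !mulr0.
have {}wi0 : 0 < w i by rewrite lt_neqAle eq_sym wi0 w0.
rewrite -ler_pdivrMr//; apply: lb_le_inf => // k [_ kP].
by rewrite ler_pdivrMr.
Qed.

Context (V : lmodType R) (L : I -> V -> R) (w : I -> R).
Hypothesis L_lin : forall i a u v, L i (a *: u + v) = a * L i u + L i v.
Hypothesis w_ge0 : forall i, 0 <= w i.
Hypothesis L_bounded : forall u, exists k, forall i, `|L i u| <= k * w i.

Definition gauge (u : V) : R := least_const (fun i => `|L i u|) w.

Lemma gaugeP u i : `|L i u| <= gauge u * w i.
Proof. exact: (least_constP w_ge0 (L_bounded u)). Qed.

Lemma gauge_ler_normD u v : gauge (u + v) <= gauge u + gauge v.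
Proof.
apply: least_const_le => [|i]; first exact: addr_ge0 (least_const_ge0 _ _) (least_const_ge0 _ _).
rewrite -[u]scale1r L_lin mul1r scale1r mulrDl.
by rewrite (le_trans (ler_normD _ _))// lerD// gaugeP.
Qed.

Let LZ i a u : L i (a *: u) = a * L i u.
Proof.
have L0 : L i 0 = 0.
  by apply: (@addrI _ (L i 0)); rewrite -{1}[L i 0]mul1r -L_lin scaler0 !addr0.
by rewrite -[a *: u]addr0 L_lin L0 addr0.
Qed.

Let gauge_leZ a u : gauge (a *: u) <= `|a| * gauge u.
Proof.
apply: least_const_le => [|i]; first by rewrite mulr_ge0 ?least_const_ge0.
by rewrite LZ normrM -mulrA ler_wpM2l// gaugeP.
Qed.

Lemma gauge_normrZ a u : gauge (a *: u) = `|a| * gauge u.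
Proof.
apply/eqP; rewrite eq_le gauge_leZ/=.
have [->|a0] := eqVneq a 0; first by rewrite normr0 mul0r least_const_ge0.
rewrite -ler_pdivlMl ?normr_gt0// -normfV.
by rewrite -{1}[u](scalerK a0) gauge_leZ.
Qed.

Lemma gauge_eq0 u : gauge u = 0 -> forall i, L i u = 0.
Proof.
move=> u0 i; apply/eqP; rewrite -normr_le0.
by have := gaugeP u i; rewrite u0 mul0r.
Qed.

End least_const.

Section general_notions.
Context {R : realType}.

Definition bounded_op (X Y : normedModType R) (f : X -> Y) :=
  exists k : R, forall x, `|f x| <= k * `|x|.

Definition lin_span (X : lmodType R) (S : set X) : set X :=
  [set x | exists n (a : 'I_n -> R) (s : 'I_n -> X),
    (forall i, S (s i)) /\ x = \sum_i a i *: s i].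

Definition separable_set (T : topologicalType) (B : set T) :=
  exists A : set T, [/\ countable A, A `<=` B & B `<=` closure A].

(* dens T <= |K| *)
Definition dens_le (T : topologicalType) (K : Type) :=
  exists A : set T, dense A /\ (A #<= [set: K])%card.

End general_notions.

(* A normed module seen as a metric space, for d(x, y) = |x - y| *)
Definition metric_of_normed (R : realType) (V : normedModType R) : Type := V.

Section metric_of_normed.
Context (R : realType) (V : normedModType R).
Local Notation T := (metric_of_normed V).

HB.instance Definition _ := PseudoMetric.on T.

Let dist (x y : T) : R := `|(x : V) - y|.

Let dist_ge0 x y : 0 <= dist x y. Proof. exact: normr_ge0. Qed.

Let dist_positivity x y : dist x y = 0 -> x = y.
Proof. by move/normr0_eq0/eqP; rewrite subr_eq0 => /eqP. Qed.

Let ballEdist (x : T) d : ball x d = [set y | dist x y < d].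
Proof. by rewrite -[LHS]/(@ball R V x d) -ball_normE. Qed.

HB.instance Definition _ :=
  PseudoMetric_isMetric.Build R T dist_ge0 dist_positivity ballEdist.

End metric_of_normed.

Section dual.
Context (R : realType) (X : normedModType R).

Definition dual_pred : {pred X -> R} := fun phi => `[<
  (forall a u v, phi (a *: u + v) = a * phi u + phi v) /\
  exists k, forall x, `|phi x| <= k * `|x| >].

Record dual := Dual { dual_val :> X -> R; _ : dual_val \in dual_pred }.

HB.instance Definition _ := [isSub for dual_val].
HB.instance Definition _ := [Choice of dual by <:].

Lemma dual_submod_closed : submod_closed dual_pred.
Proof.
split=> [|a f g /asboolP[flin [k kP]] /asboolP[glin [l lP]]]; apply/asboolP.
  split=> [b u v|]; first by rewrite /= mulr0 addr0.
  by exists 0 => x; rewrite normr0 mul0r.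
split=> [b u v|].
  by rewrite !fctE flin glin /GRing.scale/=; ring.
exists (`|a| * k + l) => x; rewrite !fctE (le_trans (ler_normD _ _))//.
by rewrite mulrDl lerD// normrM -mulrA ler_wpM2l.
Qed.

HB.instance Definition _ :=
  GRing.isSubmodClosed.Build _ _ dual_pred dual_submod_closed.
HB.instance Definition _ := [SubChoice_isSubLmodule of dual by <:].

Lemma dual_linear (phi : dual) a u v :
  phi (a *: u + v) = a * phi u + phi v.
Proof. by case: phi => phi /= /asboolP[]. Qed.

Lemma dual_bounded (phi : dual) : exists k, forall x, `|phi x| <= k * `|x|.
Proof. by case: phi => phi /= /asboolP[]. Qed.

Let eval (x : X) (phi : dual) : R := phi x.

Let eval_lin x a phi psi :
  eval x (a *: phi + psi) = a * eval x phi + eval x psi.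
Proof. by []. Qed.

Definition dual_norm : dual -> R := gauge eval Num.norm.

Let dual_norm0 phi : dual_norm phi = 0 -> phi = 0.
Proof.
move=> phi0; apply/val_inj/funext => x.
exact: (gauge_eq0 (@normr_ge0 _ _) dual_bounded phi0 x).
Qed.

HB.instance Definition _ := Lmodule_isNormed.Build R dual
  (gauge_ler_normD eval_lin (@normr_ge0 _ _) dual_bounded)
  (gauge_normrZ eval_lin (@normr_ge0 _ _) dual_bounded)
  dual_norm0.

Lemma dual_normP (phi : dual) x : `|phi x| <= `|phi| * `|x|.
Proof. exact: (gaugeP (@normr_ge0 _ _) dual_bounded). Qed.

End dual.

Section c0.
Context (R : realType) (K : choiceType).

Definition c0_pred : {pred K -> R} := fun x => `[<
  forall e, 0 < e -> finite_set [set i | e <= `|x i|] >].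

Record c0 := C0 { c0_val :> K -> R; _ : c0_val \in c0_pred }.

HB.instance Definition _ := [isSub for c0_val].
HB.instance Definition _ := [Choice of c0 by <:].

Lemma c0_submod_closed : submod_closed c0_pred.
Proof.
split=> [|a f g /asboolP fc /asboolP gc]; apply/asboolP => e e0.
  apply: (sub_finite_set _ (@finite_set0 K)) => i /=.
  by rewrite normr0 leNgt e0.
have a0 : 0 < `|a| + 1 by rewrite ltr_wpDl.
pose d := e / 2 / (`|a| + 1).
have d0 : 0 < d by rewrite !divr_gt0.
have e20 : 0 < e / 2 by rewrite divr_gt0.
have : finite_set ([set i | d <= `|f i|] `|` [set i | e / 2 <= `|g i|]).
  by rewrite finite_setU; split; [exact: fc|exact: gc].
apply: sub_finite_set => i /= ei.
have [|fi] := leP d `|f i|; first by left.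
right; rewrite leNgt; apply/negP => gi.
have : `|a * f i + g i| < e.
  rewrite (le_lt_trans (ler_normD _ _))// [ltRHS]splitr ler_ltD//.
  rewrite normrM (@le_trans _ _ ((`|a| + 1) * d))//.
    by rewrite ler_pM// ?lerDl// ltW.
  by rewrite /d mulrC divfK// gt_eqF.
by rewrite ltNge => /negP; apply.
Qed.

HB.instance Definition _ :=
  GRing.isSubmodClosed.Build _ _ c0_pred c0_submod_closed.
HB.instance Definition _ := [SubChoice_isSubLmodule of c0 by <:].

Lemma c0_bounded (x : c0) : exists k, forall i, `|x i| <= k * 1.
Proof.
case: x => x /= /asboolP/(_ 1 ltr01)/finite_seqP[s sE].
exists (1 + \sum_(j <- s) `|x j|) => i; rewrite mulr1.
have s0 : 0 <= \sum_(j <- s) `|x j| by apply: sumr_ge0.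
have [xi|/ltW xi] := leP 1 `|x i|; last by rewrite (le_trans xi)// lerDl.
have si : i \in s by have : [set` s] i by rewrite -sE.
by rewrite (big_rem i)//= addrCA lerDl addr_ge0// sumr_ge0.
Qed.

Let eval (i : K) (x : c0) : R := x i.

Let eval_lin i a x y : eval i (a *: x + y) = a * eval i x + eval i y.
Proof. by []. Qed.

Let w_ge0 (i : K) : 0 <= (1 : R). Proof. by []. Qed.

(* the supremum norm *)
Definition c0_norm : c0 -> R := gauge eval (fun=> 1).

Let c0_norm0 x : c0_norm x = 0 -> x = 0.
Proof.
by move=> x0; apply/val_inj/funext => i; exact: (gauge_eq0 w_ge0 c0_bounded x0 i).
Qed.

HB.instance Definition _ := Lmodule_isNormed.Build R c0
  (gauge_ler_normD eval_lin w_ge0 c0_bounded)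
  (gauge_normrZ eval_lin w_ge0 c0_bounded)
  c0_norm0.

End c0.

Section lip0.
Context (R : realType) (M : metricType R) (o : M).

Definition lip0_pred : {pred M -> R} := fun f => `[<
  f o = 0 /\ exists k, forall x y, `|f x - f y| <= k * mdist x y >].

Record lip0 := Lip0 { lip0_val :> M -> R; _ : lip0_val \in lip0_pred }.

HB.instance Definition _ := [isSub for lip0_val].
HB.instance Definition _ := [Choice of lip0 by <:].

Lemma lip0_submod_closed : submod_closed lip0_pred.
Proof.
split=> [|a f g /asboolP[f0 [k kP]] /asboolP[g0 [l lP]]]; apply/asboolP.
  by split=> //; exists 0 => x y; rewrite subrr normr0 mul0r.
split; first by rewrite !fctE f0 g0 /GRing.scale/= mulr0 addr0.
exists (`|a| * k + l) => x y; rewrite !fctE.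
have -> : a *: f x + g x - (a *: f y + g y) =
    a * (f x - f y) + (g x - g y) by rewrite /GRing.scale/=; ring.
rewrite (le_trans (ler_normD _ _))//.
by rewrite mulrDl lerD// normrM -mulrA ler_wpM2l.
Qed.

HB.instance Definition _ :=
  GRing.isSubmodClosed.Build _ _ lip0_pred lip0_submod_closed.
HB.instance Definition _ := [SubChoice_isSubLmodule of lip0 by <:].

Lemma lip0_base (f : lip0) : f o = 0.
Proof. by case: f => f /= /asboolP[]. Qed.

Let slope (xy : M * M) (f : lip0) : R := f xy.1 - f xy.2.
Let w (xy : M * M) : R := mdist xy.1 xy.2.

Let slope_lin i a f g : slope i (a *: f + g) = a * slope i f + slope i g.
Proof.
rewrite /slope; have E z : (a *: f + g) z = a * f z + g z by [].
by rewrite !E; ring.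
Qed.

Let w_ge0 i : 0 <= w i. Proof. exact: mdist_ge0. Qed.

Let slope_bounded (f : lip0) : exists k, forall i, `|slope i f| <= k * w i.
Proof.
have /asboolP[_ [k kP]] := valP f.
by exists k => -[x y]; exact: kP.
Qed.

(* the best Lipschitz constant *)
Definition lip0_norm : lip0 -> R := gauge slope w.

Let lip0_norm0 f : lip0_norm f = 0 -> f = 0.
Proof.
move=> f0; apply/val_inj/funext => x.
have := gauge_eq0 w_ge0 slope_bounded f0 (x, o).
by rewrite /slope/= lip0_base subr0.
Qed.

HB.instance Definition _ := Lmodule_isNormed.Build R lip0
  (gauge_ler_normD slope_lin w_ge0 slope_bounded)
  (gauge_normrZ slope_lin w_ge0 slope_bounded)
  lip0_norm0.

Lemma lip0_normP (f : lip0) x y : `|f x - f y| <= `|f| * mdist x y.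
Proof. exact: (gaugeP w_ge0 slope_bounded f (x, y)). Qed.

Fact delta_subproof (x : M) :
  (fun f : lip0 => f x) \in @dual_pred R lip0.
Proof.
apply/asboolP; split=> //; exists (mdist x o) => f.
by have := lip0_normP f x o; rewrite lip0_base subr0 mulrC.
Qed.

Definition delta (x : M) : dual lip0 := Dual (delta_subproof x).

End lip0.

Section closed_span.
Context (R : realType) (X : normedModType R).
Implicit Types S A : set X.

Lemma closure_normP A (x : X) :
  closure A x <-> forall e, 0 < e -> exists2 y, A y & `|x - y| < e.
Proof.
split=> [Ax e e0|Ax B /nbhs_ballP[e /= e0 eB]].
  have [y [Ay xy]] := Ax _ (nbhsx_ballx x e e0).
  by exists y => //; move: xy; rewrite -ball_normE.
have [y Ay xy] := Ax e e0; exists y; split=> //.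
by apply: eB; rewrite -ball_normE.
Qed.

Lemma lin_span0 S : lin_span S 0.
Proof.
by exists 0%N, (fun=> 0), (fun=> 0); split=> [[]//|]; rewrite big_ord0.
Qed.

Lemma lin_span_lin S a x y :
  lin_span S x -> lin_span S y -> lin_span S (a *: x + y).
Proof.
move=> [m [b [s [sS ->]]]] [n [c [t [tS ->]]]].
exists (m + n)%N.
exists (fun i => match fintype.split i with inl j => a * b j | inr j => c j end).
exists (fun i => match fintype.split i with inl j => s j | inr j => t j end).
split=> [i|]; first by case: fintype.split.
rewrite big_split_ord/= scaler_sumr; congr (_ + _); apply: eq_bigr => i _.
  by rewrite -[lshift _ _]/(fintype.unsplit (inl i)) fintype.unsplitK scalerA.
by rewrite -[rshift _ _]/(fintype.unsplit (inr i)) fintype.unsplitK.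
Qed.

Lemma closed_span_lin S a x y : closure (lin_span S) x ->
  closure (lin_span S) y -> closure (lin_span S) (a *: x + y).
Proof.
move=> /closure_normP Sx /closure_normP Sy; apply/closure_normP => e e0.
have a0 : 0 < `|a| + 1 by rewrite ltr_wpDl.
have d0 : 0 < e / 2 / (`|a| + 1) by rewrite !divr_gt0.
have [u Su xu] := Sx _ d0.
have [v Sv yv] := Sy (e / 2) (divr_gt0 e0 (ltr0Sn _ 1)).
exists (a *: u + v); first exact: lin_span_lin.
have -> : a *: x + y - (a *: u + v) = a *: (x - u) + (y - v).
  by rewrite scalerBr opprD addrACA.
rewrite (le_lt_trans (ler_normD _ _))// [ltRHS]splitr ler_ltD//.
rewrite normrZ (@le_trans _ _ ((`|a| + 1) * (e / 2 / (`|a| + 1))))//.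
  by rewrite ler_pM// ?lerDl// ltW.
by rewrite mulrC divfK// gt_eqF.
Qed.

End closed_span.

Section lipfree.
Context (R : realType) (M : metricType R) (o : M).

Definition lipfree_pred : {pred dual (lip0 o)} := fun phi => `[<
  closure (lin_span (range (delta o))) phi >].

(* the Lipschitz-free space F(M), with the norm of Lip_0(M)^* *)
Record lipfree := LipFree {
  lipfree_val :> dual (lip0 o);
  _ : lipfree_val \in lipfree_pred }.

HB.instance Definition _ := [isSub for lipfree_val].
HB.instance Definition _ := [Choice of lipfree by <:].

Lemma lipfree_submod_closed : submod_closed lipfree_pred.
Proof.
split=> [|a f g /asboolP fS /asboolP gS]; apply/asboolP.
  exact/subset_closure/lin_span0.
exact: closed_span_lin.
Qed.

HB.instance Definition _ :=
  GRing.isSubmodClosed.Build _ _ lipfree_pred lipfree_submod_closed.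
HB.instance Definition _ := [SubChoice_isSubLmodule of lipfree by <:].

Definition lipfree_norm (mu : lipfree) : R := `|lipfree_val mu|.

Let lipfree_normD mu nu :
  lipfree_norm (mu + nu) <= lipfree_norm mu + lipfree_norm nu.
Proof. exact: ler_normD. Qed.

Let lipfree_normZ a mu : lipfree_norm (a *: mu) = `|a| * lipfree_norm mu.
Proof. exact: normrZ. Qed.

Let lipfree_norm0 mu : lipfree_norm mu = 0 -> mu = 0.
Proof. by move=> /normr0_eq0 mu0; exact/val_inj. Qed.

HB.instance Definition _ := Lmodule_isNormed.Build R lipfree
  lipfree_normD lipfree_normZ lipfree_norm0.

(* (Lip_0(M), w^* ): f in Lip_0(M) is identified with the functional       *)
(* mu |-> mu(f) on F(M), and w^* is the topology of pointwise convergence  *)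
(* on F(M).                                                                *)
Definition lip0_pairing (f : lip0 o) : {ptws lipfree -> R} :=
  fun mu : lipfree => mu f.

Definition lip0_wstar : Type := initial_topology lip0_pairing.

HB.instance Definition _ := Topological.on lip0_wstar.

End lipfree.

Section bases_and_skeletons.
Context {R : realType}.

Definition has_markushevich_basis (X : normedModType R) :=
  exists (I : Type) (x : I -> X) (x' : I -> dual X),
    [/\ forall i, x' i (x i) = 1,
        forall i j, i <> j -> x' i (x j) = 0,
        closure (lin_span (range x)) = [set: X]
      & forall u v : X, (forall i, x' i u = x' i v) -> u = v].

(* s is strictly increasing and t is its supremum *)
Definition increasing_to d (G : porderType d) (s : nat -> G) (t : G) :=
  [/\ forall n, (s n < s n.+1)%O,
      forall n, (s n <= t)%O
    & forall u, (forall n, (s n <= u)%O) -> (t <= u)%O].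

Record projectional_skeleton (X : normedModType R) d (G : porderType d)
    (P : G -> {linear X -> X}) : Prop := {
  skeleton_directed : forall s t : G, exists u, (s <= u)%O /\ (t <= u)%O;
  skeleton_sup : forall s : nat -> G, (forall n, (s n < s n.+1)%O) ->
    exists t, increasing_to s t;
  skeleton_bounded : forall s, bounded_op (P s);
  skeleton_proj : forall s x, P s (P s x) = P s x;
  skeleton_separable : forall s, separable_set (range (P s));
  skeleton_cover : \bigcup_s range (P s) = [set: X];
  skeleton_comm : forall s t, (s <= t)%O -> forall x,
    P s x = P s (P t x) /\ P s x = P t (P s x);
  skeleton_continuous : forall s t, increasing_to s t ->
    range (P t) = closure (\bigcup_n range (P (s n)))
}.

Definition has_projectional_skeleton (X : normedModType R) :=
  exists d (G : porderType d) (P : G -> {linear X -> X}),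
    projectional_skeleton P.

End bases_and_skeletons.

(* Main.v *)
Require Import Defs.
From mathcomp Require Import all_boot all_order all_algebra.
From mathcomp Require Import all_classical all_reals all_analysis.
From mathcomp Require wochoice.
From mathcomp Require Import lra.
Set Implicit Arguments.
Unset Strict Implicit.
Unset Printing Implicit Defensive.

Import Order.TTheory GRing.Theory Num.Theory.
Import numFieldNormedType.Exports.
Local Open Scope classical_set_scope.
Local Open Scope ring_scope.

(* Weak* separability. Let (u_g) be the coordinates, seen in Lip_0(M), of an    *)
(* injection of F(M) into c_0(2^N). For a finite binary word s, the supremum    *)
(* over the g extending s of the positive parts of u_g is Lipschitz, uniformly  *)
(* in s; as s runs through the prefixes of g it converges pointwise, hence      *)
(* weak*, to the positive part of u_g, because (u_h(x))_h is in c_0. The same   *)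
(* holds for -u_g, so these countably many functions separate F(M), and their   *)
(* rational span is weak* dense. A Markushevich basis of F(M) has at most       *)
(* continuum many elements, since its normalised vectors are 1-separated, and   *)
(* its functionals form such a family.                                          *)
(*                                                                              *)
(* Skeletons. A projectional skeleton of X gives a bounded projection P_A for   *)
(* every directed set A of indices, which linearises to a projection of F(X).   *)
(* If A is contained in D, closing index sets under countably many further      *)
(* operations makes the projections act on range P_D /\ ker P_A, so this space  *)
(* carries a structure of the same kind. Transfinite induction along a          *)
(* well-order of the indices splits F(X) into separable pieces, which have      *)
(* Markushevich bases by Gram-Schmidt; these bases are glued together.          *)

(** * Closed linear spans *)

(** Weak* separability is reduced in two steps. By [wstar_separable_of_separating], a countable
    subset of Lip_0(M) separating the points of F(M) suffices: its linear span interpolates any f on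
    finitely many elements of F(M) ([lipfree_interpolation]), and rational coefficients do so
    approximately. By [wstar_separable_of_c0_family], such a set exists once there is a bounded
    family (u_g), indexed by 2^N, that separates F(M) and is c_0 at every point of M: along the
    cylinders shrinking to g, the suprema of the positive parts converge to the positive part of
    u_g, and bounded pointwise convergence is weak* convergence ([wstar_limit]). An injection into
    c_0 yields the family through its coordinates; a Markushevich basis yields it through its
    normalised functionals, after its index set is embedded in 2^N.

    For a skeleton on X, uniform bounds on a cofinal set of indices ([skeleton_uniform]) make the
    projections converge along directed sets ([directed_limit]), and [lipfree_push] carries the
    limits over to F(X), which thus becomes [skeletal]. Let D_x and C_x be the stable sets generated
    by the indices up to x, and strictly before x, in a well-order. The pieces range P_{D_x} /\ ker
    P_{C_x} are skeletal again ([skeletal_refine]); [mbasis_chain] unites bases of the pieces, and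
    [mbasis_upto] runs the induction, whose countably generated case is Gram-Schmidt
    ([markushevich]). *)

Lemma countable_enum (T : choiceType) (x0 : T) (A : set T) : countable A ->
  exists (w : nat -> T) (j : T -> nat),
    (forall n, w n = x0 \/ A (w n)) /\ forall x, A x -> w (j x) = x.
Proof.
move=> /countable_injP[j jinj].
exists (fun n => xget x0 [set y | A y /\ j y = n]), j; split=> [n|x Ax].
  by case: xgetP => [z _ [Az _]|_]; [right|left].
case: xgetP => [z _ [Az /jinj]|/(_ x) h]; last by exfalso; apply: h.
by apply; rewrite inE.
Qed.

Lemma countable_setU (T : Type) (A B : set T) :
  countable A -> countable B -> countable (A `|` B).
Proof.
move=> cA cB.
have : countable (\bigcup_(b in [set: bool]) if b then A else B).
  by apply: bigcup_countable => [|[] _].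
apply/sub_countable/subset_card_le => x [Ax|Bx]; [by exists true|by exists false].
Qed.

Section span_facts.
Context {R : realType} {Y : normedModType R}.
Implicit Types (W V K Z : set Y) (x y z u v : Y).

Definition lin_set K := K 0 /\ forall (a : R) u v, K u -> K v -> K (a *: u + v).

Definition clspan W : set Y := closure (lin_span W).

Lemma norm_small_eq0 {V : normedModType R} (x : V) (k : R) :
  (forall e, 0 < e -> `|x| <= k * e) -> x = 0.
Proof.
move=> h; apply/eqP; rewrite -normr_le0; apply/ler_addgt0Pr => e e0.
have k1 : 0 < `|k| + 1 by rewrite ltr_wpDl.
rewrite add0r (le_trans (h _ (divr_gt0 e0 k1)))//.
rewrite mulrCA ger_pMr// ler_pdivrMr// mul1r.
by rewrite (le_trans (ler_norm k))// lerDl.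
Qed.

Lemma natSinv_lt (e : R) : 0 < e -> exists n, n.+1%:R^-1 < e.
Proof.
move=> e0; exists (Num.truncn e^-1).
by rewrite invf_plt ?posrE// truncnS_gt.
Qed.

Lemma lin_setT : lin_set [set: Y].
Proof. by []. Qed.

Lemma lin_setD K u v : lin_set K -> K u -> K v -> K (u + v).
Proof. by case=> _ h Ku Kv; rewrite -[u]scale1r; exact: h. Qed.

Lemma lin_setZ K a u : lin_set K -> K u -> K (a *: u).
Proof. by case=> K0 h Ku; rewrite -[_ *: u]addr0; exact: h. Qed.

Lemma lin_setB K u v : lin_set K -> K u -> K v -> K (u - v).
Proof. by case=> _ h Ku Kv; rewrite addrC -scaleN1r; exact: h. Qed.

Lemma lin_set_sum K (I : Type) (r : seq I) (c : pred I) (f : I -> Y) :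
  lin_set K -> (forall i, c i -> K (f i)) -> K (\sum_(i <- r | c i) f i).
Proof.
move=> linK Kf; apply: (big_ind K) => //; first exact: linK.1.
by move=> u v; exact: lin_setD.
Qed.

Lemma lin_span_min K W : lin_set K -> W `<=` K -> lin_span W `<=` K.
Proof.
move=> linK WK _ [n [a [s [sW ->]]]]; apply: lin_set_sum => // i _.
by apply: lin_setZ => //; exact: WK.
Qed.

Lemma sub_lin_span W : W `<=` lin_span W.
Proof.
move=> x Wx; exists 1%N, (fun=> 1), (fun=> x); split=> //.
by rewrite big_ord1 scale1r.
Qed.

Lemma lin_set_span W : lin_set (lin_span W).
Proof. by split=> [|a u v]; [exact: lin_span0|exact: lin_span_lin]. Qed.

Lemma lin_set_clspan W : lin_set (clspan W).
Proof.
split=> [|a u v]; [exact/subset_closure/lin_span0|exact: closed_span_lin].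
Qed.

Lemma sub_clspan W : W `<=` clspan W.
Proof. by move=> x /sub_lin_span; exact: subset_closure. Qed.

Lemma closure_closureS W : closure (closure W) `<=` closure W.
Proof. by rewrite -((closure_id _).1 (@closed_closure _ W)). Qed.

Lemma clspan_min K W :
  lin_set K -> closure K `<=` K -> W `<=` K -> clspan W `<=` K.
Proof.
move=> linK clK WK; apply: subset_trans clK.
by apply: closure_subset; exact: lin_span_min.
Qed.

Lemma clspan_sub W V : W `<=` clspan V -> clspan W `<=` clspan V.
Proof.
by apply: clspan_min; [exact: lin_set_clspan|exact: closure_closureS].
Qed.

Lemma clspanS W V : W `<=` V -> clspan W `<=` clspan V.
Proof. by move=> WV; apply/clspan_sub/(subset_trans WV)/sub_clspan. Qed.

Lemma clspan_approx W x e : clspan W x -> 0 < e ->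
  exists2 y, lin_span W y & `|x - y| < e.
Proof. by move=> /closure_normP; apply. Qed.

(** A limit of a sequence of finite combinations involves only countably many vectors. This is what
    lets closing-off arguments proceed by countable steps. *)
Lemma clspan_countable W x : clspan W x ->
  exists V, [/\ countable V, V `<=` W & clspan V x].
Proof.
move=> Wx.
have /choice[y yP] n : exists y, lin_span W y /\ `|x - y| < n.+1%:R^-1.
  have n0 : 0 < n.+1%:R^-1 :> R by [].
  by have [y Wy xy] := clspan_approx Wx n0; exists y.
have /choice[d dP] n : exists d : {m & 'I_m -> Y}, (forall i, W (projT2 d i)) /\
    lin_span (range (projT2 d)) (y n).
  have [[m [a [s [sW yE]]]] _] := yP n; exists (existT _ m s); split=> //=.
  have linS := lin_set_span (range s).
  rewrite yE; apply: (lin_set_sum _ linS) => i _.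
  by apply: (lin_setZ _ linS); exact: sub_lin_span.
exists (\bigcup_n range (projT2 (d n))); split.
- apply: bigcup_countable => // n _; exact/finite_set_countable/finite_image.
- by move=> _ [n _ [i _ <-]]; exact: (dP n).1.
- apply/closure_normP => e e0.
  have [n ne] := natSinv_lt e0.
  exists (y n); last exact: lt_trans (yP n).2 ne.
  apply: (lin_span_min (lin_set_span _)) (dP n).2.
  by move=> u du; apply: sub_lin_span; exists n.
Qed.

(** Bounded linearity is required on [Z] only and [f] stays a total function, so that ranges and
    kernels are handled as subsets of one ambient space. *)
Definition op_on (V : normedModType R) Z (k : R) (f : Y -> V) :=
  (forall (a : R) u v, Z u -> Z v -> f (a *: u + v) = a *: f u + f v) /\
  forall u, Z u -> `|f u| <= k * `|u|.

Section op_on.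
Variables (V : normedModType R) (Z : set Y).
Lemma op_on_comp (Z' : set Y) (k l : R) (f : Y -> Y) (g : Y -> V) : 0 <= l ->
  op_on Z k f -> (forall u, Z u -> Z' (f u)) -> op_on Z' l g ->
  op_on Z (l * k) (g \o f).
Proof.
move=> l0 [fl fb] fZ [gl gb]; split=> [a u v Zu Zv /=|u Zu /=].
  by rewrite fl// gl//; exact: fZ.
by rewrite (le_trans (gb _ (fZ _ Zu)))// -mulrA ler_wpM2l// fb.
Qed.

Hypothesis linZ : lin_set Z.

Lemma op_on0 k (f : Y -> V) : op_on Z k f -> f 0 = 0.
Proof.
by move=> [_ /(_ 0 linZ.1)]; rewrite normr0 mulr0 normr_le0 => /eqP.
Qed.

Lemma op_onB k (f : Y -> V) u v : op_on Z k f -> Z u -> Z v ->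
  f (u - v) = f u - f v.
Proof.
by case=> h _ Zu Zv; rewrite addrC -scaleN1r h// scaleN1r addrC.
Qed.

Lemma op_on_lin a k l (f g : Y -> V) : op_on Z k f -> op_on Z l g ->
  op_on Z (`|a| * k + l) (fun u => a *: f u + g u).
Proof.
move=> [fl fb] [gl gb]; split=> [b u v Zu Zv|u Zu].
  rewrite fl// gl// !scalerDr !scalerA [b * a]mulrC -!addrA; congr (_ + _).
  by rewrite addrCA.
rewrite (le_trans (ler_normD _ _))// mulrDl lerD//; last exact: gb.
by rewrite normrZ -mulrA ler_wpM2l// fb.
Qed.

Hypothesis clZ : closure Z `<=` Z.

Lemma op_on_ker_lin k (f : Y -> V) : op_on Z k f ->
  lin_set [set z | Z z /\ f z = 0].
Proof.
move=> fop; split=> [|a u v [Zu fu] [Zv fv]].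
  by split; [exact: linZ.1|exact: op_on0 fop].
split; first exact: linZ.2.
by rewrite fop.1// fu fv scaler0 addr0.
Qed.

Lemma op_on_ker_closed k (f : Y -> V) : op_on Z k f ->
  closure [set z | Z z /\ f z = 0] `<=` [set z | Z z /\ f z = 0].
Proof.
move=> fop x xcl.
have Zx : Z x by apply: clZ; apply: closure_subset xcl => y [].
split=> //; apply: (@norm_small_eq0 _ _ `|k|) => e e0.
have /closure_normP/(_ e e0)[y [Zy fy] xy] := xcl.
rewrite -[f x]subr0 -fy -(op_onB fop)//.
apply: le_trans (fop.2 _ (lin_setB linZ Zx Zy)) _.
rewrite (@le_trans _ _ (`|k| * `|x - y|))//.
  by rewrite ler_wpM2r// ler_norm.
by rewrite ler_wpM2l// ltW.
Qed.

End op_on.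

End span_facts.

(** * Skeletal structures and their restriction to kernels *)

Section stable.
Variable S : Type.
Implicit Types (F : S -> S -> set S) (A B G : set S).

(** A multivalued binary operation: choosing upper bounds and adjoining countable sets of auxiliary
    indices both take this form. *)
Definition stable F A := forall a b, A a -> A b -> F a b `<=` A.

Definition gen F G : set S := [set x | forall A, stable F A -> G `<=` A -> A x].

Lemma stable_gen F G : stable F (gen F G).
Proof.
move=> a b Ga Gb x Fx A Ast GA.
exact: (Ast a b (Ga _ Ast GA) (Gb _ Ast GA)).
Qed.

Lemma sub_gen F G : G `<=` gen F G.
Proof. by move=> x Gx A _; exact. Qed.

Lemma gen_min F G A : stable F A -> G `<=` A -> gen F G `<=` A.
Proof. by move=> Ast GA x; exact. Qed.

Lemma genS F G A : G `<=` A -> gen F G `<=` gen F A.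
Proof.
move=> GA; apply: gen_min; first exact: stable_gen.
exact: subset_trans GA (@sub_gen _ _).
Qed.

Lemma stableI F A B : stable F A -> stable F B -> stable F (A `&` B).
Proof.
move=> As Bs a b [Aa Ba] [Ab Bb] x Fx.
by split; [exact: As Fx|exact: Bs Fx].
Qed.

Lemma stableW F F' A : (forall a b, F a b `<=` F' a b) ->
  stable F' A -> stable F A.
Proof. by move=> FF' As a b Aa Ab x /FF'; exact: As. Qed.

(** As [F] takes two arguments only, adjoining its values omega times already gives a stable set. *)
Lemma countable_gen F G : (forall a b, countable (F a b)) ->
  countable G -> countable (gen F G).
Proof.
move=> cF cG.
pose step A := A `|` \bigcup_(p in A `*` A) F p.1 p.2.
have cI n : countable (iter n step G).
  elim: n => [//|n IH]; rewrite iterS /step; apply: countable_setU => //.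
  by apply: bigcup_countable => [|p _]; [exact: countableX|exact: cF].
have mono m n : (m <= n)%N -> iter m step G `<=` iter n step G.
  elim: n => [|n IH]; first by rewrite leqn0 => /eqP ->.
  rewrite leq_eqVlt => /predU1P[->//|/IH]; rewrite iterS => h x /h; by left.
have cU : countable (\bigcup_n iter n step G) by exact: bigcup_countable.
apply: sub_countable cU; apply/subset_card_le.
apply: gen_min => [|x Gx]; last by exists 0%N.
move=> a b [m _ am] [n _ bn] x Fx; exists (maxn m n).+1 => //.
rewrite iterS; right; exists (a, b) => //; split=> /=.
  by apply: mono am; exact: leq_maxl.
by apply: mono bn; exact: leq_maxr.
Qed.

End stable.

Section skeletal.
Context {R : realType} {Y : normedModType R} {S : Type}.
Implicit Types (Z : set Y) (A B C D N : set S) (F : S -> S -> set S).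
Implicit Types (P : set S -> Y -> Y) (q : S -> nat -> Y).

Definition span_of q A : set Y := [set y | exists s n, A s /\ y = q s n].

(* A projectional skeleton seen from all index sets at once: P A is a          *)
(* projection of Z for every A `<=` B closed under F, whatever its cardinal,   *)
(* and q lists, for each index, countably many vectors that span the ranges.   *)
(* Enlarging F only leaves fewer closed sets, so conditions met by closing off *)
(* countably often can be built into F.                                        *)
Record skeletal Z B F P q (k : R) : Prop := Skeletal {
  sk_lin : lin_set Z ;
  sk_closed : closure Z `<=` Z ;
  sk_countable : forall a b, countable (F a b) ;
  sk_index : stable F B ;
  sk_const : 0 <= k ;
  sk_op : forall A, stable F A -> A `<=` B -> op_on Z k (P A) ;
  sk_sub : forall A z, stable F A -> A `<=` B -> Z z -> Z (P A z) ;
  sk_le : forall A A' z, stable F A -> stable F A' -> A `<=` A' -> A' `<=` B ->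
    Z z -> P A (P A' z) = P A z /\ P A' (P A z) = P A z ;
  sk_id : forall z, Z z -> P B z = z ;
  sk_gen : forall s n, B s -> Z (q s n) ;
  sk_fix : forall A s n, stable F A -> A `<=` B -> A s -> P A (q s n) = q s n ;
  sk_span : forall A z, stable F A -> A `<=` B -> Z z -> P A z = z ->
    clspan (span_of q A) z }.

Definition fix_in Z P A : set Y := [set z | Z z /\ P A z = z].

Section facts.
Variables (Z : set Y) (B : set S) (F : S -> S -> set S).
Variables (P : set S -> Y -> Y) (q : S -> nat -> Y) (k : R).
Hypothesis sk : skeletal Z B F P q k.

Lemma op_on_fixB A : stable F A -> A `<=` B ->
  op_on Z (k + 1) (fun u => P A u - u).
Proof.
move=> As AB; have Aop := sk_op sk As AB; split=> [a u v Zu Zv|u Zu].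
  by rewrite Aop.1// scalerBr opprD addrACA.
by rewrite (le_trans (ler_normB _ _))// mulrDl mul1r lerD2r Aop.2.
Qed.

(** Seen as a kernel, the range of [P A] gets its linearity and closedness from [op_on_ker_lin] and
    [op_on_ker_closed]. *)
Lemma fix_inE A : fix_in Z P A = [set z | Z z /\ P A z - z = 0].
Proof.
apply/seteqP; split=> z [Zz h]; split=> //; first by rewrite h subrr.
exact: subr0_eq.
Qed.

Lemma fix_in_lin A : stable F A -> A `<=` B -> lin_set (fix_in Z P A).
Proof.
move=> As AB; rewrite fix_inE.
exact: (op_on_ker_lin (sk_lin sk) (op_on_fixB As AB)).
Qed.

Lemma fix_in_closed A : stable F A -> A `<=` B ->
  closure (fix_in Z P A) `<=` fix_in Z P A.
Proof.
move=> As AB; rewrite fix_inE.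
exact: (op_on_ker_closed (sk_lin sk) (sk_closed sk) (op_on_fixB As AB)).
Qed.

Lemma fix_in_clspan A W : stable F A -> A `<=` B -> W `<=` fix_in Z P A ->
  clspan W `<=` fix_in Z P A.
Proof.
by move=> As AB; apply: clspan_min; [exact: fix_in_lin|exact: fix_in_closed].
Qed.

Lemma span_of_fix A N : stable F A -> A `<=` B -> N `<=` A ->
  span_of q N `<=` fix_in Z P A.
Proof.
move=> As AB NA _ [s [n [/NA Ass ->]]]; split; first exact/(sk_gen sk)/AB.
exact: (sk_fix sk).
Qed.

Lemma fix_in_P A z : stable F A -> A `<=` B -> Z z -> fix_in Z P A (P A z).
Proof.
move=> As AB Zz; split; first exact: (sk_sub sk).
by have [] := sk_le sk As As (@subset_refl _ A) AB Zz.
Qed.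

Lemma fix_inS A A' : stable F A -> stable F A' -> A `<=` A' -> A' `<=` B ->
  fix_in Z P A `<=` fix_in Z P A'.
Proof.
move=> As A's AA' A'B z [Zz <-]; split.
  by apply: (sk_sub sk) => //; exact: subset_trans A'B.
by have [] := sk_le sk As A's AA' A'B Zz.
Qed.

(* P A maps the range of P N into that of P (A `&` N) as soon as it does so    *)
(* for the generators attached to the indices in N; closing the indices under  *)
(* F' achieves this, and then P N preserves the kernel of P A.                 *)
Lemma skeletal_refine A D : stable F A -> stable F D -> A `<=` D -> D `<=` B ->
  exists F' q' k', [/\ forall a b, F a b `<=` F' a b,
    skeletal [set z | [/\ Z z, P D z = z & P A z = 0]] D F' P q' k' &
    stable F' D].
Proof.
move=> As Ds AD DB.
have AB := subset_trans AD DB.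
have linZ := sk_lin sk.
(* [T s] is a countable set of indices in [A] whose generators span all the vectors [P A (q s n)];
   it will be adjoined to the values of [F]. *)
have /choice[T TP] (s : S) : exists T : set S, [/\ countable T, T `<=` A &
    B s -> forall n, clspan (span_of q T) (P A (q s n))].
  have [Bs|nBs] := pselect (B s); last first.
    by exists set0; split=> //; exact: countable0.
  have /choice[V VP] n : exists V : set S, [/\ countable V, V `<=` A &
      clspan (span_of q V) (P A (q s n))].
    have [Zq Pq] := fix_in_P As AB (sk_gen sk n Bs).
    have [V [cV VA Vy]] := clspan_countable (sk_span sk As AB Zq Pq).
    have /choice[f fP] y : exists a, V y -> A a /\ exists n, y = q a n.
      have [/VA[a [m [Aa ->]]]|//] := pselect (V y); last by exists s.
      by exists a => _; split=> //; exists m.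
    exists (f @` V); split.
    - apply: sub_countable cV; exact: card_image_le.
    - by move=> _ [y Vy' <-]; have [] := fP _ Vy'.
    - apply: clspanS Vy => y Vy'; have [_ [m ym]] := fP _ Vy'.
      by exists (f y), m; split=> //; exists y.
  exists (\bigcup_n V n); split.
  - by apply: bigcup_countable => // n _; have [] := VP n.
  - by move=> x [n _]; have [_ + _] := VP n; exact.
  - move=> _ n; have [_ _] := VP n; apply: clspanS => _ [a [m [Va ->]]].
    by exists a, m; split=> //; exists n.
pose F' a b := F a b `|` T a.
have FF' a b : F a b `<=` F' a b by left.
(* The conclusion is a closed linear condition on z, so it is tested on the generators [q s n],
   where stability under [F'] puts [T s] inside the intersection of [A] and [N]. *)
have key N z : stable F' N -> N `<=` D -> fix_in Z P N z ->
    fix_in Z P (A `&` N) (P A z).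
  move=> N's ND [Zz Nz]; have Ns := stableW FF' N's.
  have NB := subset_trans ND DB.
  have ANs := stableI As Ns.
  have ANB : A `&` N `<=` B by move=> x [/AB].
  have AANop : op_on Z (k * k + k) (fun z => P (A `&` N) (P A z) - P A z).
    have Aop := sk_op sk As AB; have ANop := sk_op sk ANs ANB.
    have AZ u : Z u -> Z (P A u) by exact: (sk_sub sk).
    split=> [a u v Zu Zv|u Zu].
      by rewrite Aop.1// ANop.1//; [rewrite scalerBr opprD addrACA|exact: AZ|exact: AZ].
    rewrite (le_trans (ler_normB _ _))// mulrDl lerD ?Aop.2//.
    rewrite (le_trans (ANop.2 _ (AZ _ Zu)))// -mulrA ler_wpM2l ?Aop.2//.
    exact: sk_const sk.
  suff : clspan (span_of q N) `<=`
      [set z | Z z /\ P (A `&` N) (P A z) - P A z = 0].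
    move=> /(_ _ (sk_span sk Ns NB Zz Nz))[_ /subr0_eq h]; split=> //.
    exact: (sk_sub sk).
  apply: clspan_min; first exact: (op_on_ker_lin linZ AANop).
    exact: (op_on_ker_closed linZ (sk_closed sk) AANop).
  move=> _ [s [n [Nsm ->]]]; split; first exact/(sk_gen sk)/NB.
  have [_ TA Ts] := TP s.
  have TAN : T s `<=` A `&` N.
    by move=> x Tx; split; [exact: TA|apply: (N's s s) => //; right].
  have := span_of_fix ANs ANB TAN.
  move/(fix_in_clspan ANs ANB)/(_ _ (Ts (NB _ Nsm) n)) => -[_ ->].
  by rewrite subrr.
pose Z' := [set z | [/\ Z z, P D z = z & P A z = 0]].
pose q' s n := q s n - P A (q s n).
have F'D : stable F' D.
  move=> a b Da Db x [|Tx]; first exact: Ds.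
  by apply: AD; have [_ + _] := TP a; exact.
have Z'E : Z' = fix_in Z P D `&` [set z | Z z /\ P A z = 0].
  by apply/seteqP; split=> z; [case=> Zz Dz Az|case=> -[Zz Dz] [_ Az]].
have fixB N z : stable F' N -> N `<=` D -> fix_in Z P N z ->
    Z' (z - P A z) /\ P N (z - P A z) = z - P A z.
  move=> N's ND Nz; have Ns := stableW FF' N's; have NB := subset_trans ND DB.
  have Zz : Z z by case: Nz.
  have NAz : fix_in Z P N (P A z).
    apply: (fix_inS (stableI As Ns) Ns (@subIsetr _ A N) NB).
    exact: key.
  have [ZzA NzA] := lin_setB (fix_in_lin Ns NB) Nz NAz.
  split=> //; split=> //.
    by have [] := fix_inS Ns Ds ND DB (conj ZzA NzA).
  rewrite (op_onB (sk_op sk As AB))//; last by case: NAz.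
  by have [_ ->] := fix_in_P As AB Zz; rewrite subrr.
exists F', q', (k + 1); split=> //; split=> //.
- rewrite -/Z' Z'E; have [f0 fl] := fix_in_lin Ds DB.
  have [g0 gl] := op_on_ker_lin linZ (sk_op sk As AB).
  by split=> // a u v [fu gu] [fv gv]; split; [exact: fl|exact: gl].
- rewrite -/Z' Z'E => z zcl; split.
    by apply: (fix_in_closed Ds DB); apply: closure_subset zcl => x [].
  apply: (op_on_ker_closed linZ (sk_closed sk) (sk_op sk As AB)).
  by apply: closure_subset zcl => x [].
- move=> a b; apply: countable_setU; first exact: (sk_countable sk).
  by have [] := TP a.
- by rewrite addr_ge0// (sk_const sk).
- move=> N N's ND; have Nop := sk_op sk (stableW FF' N's) (subset_trans ND DB).
  split=> [a u v [Zu _ _] [Zv _ _]|u [Zu _ _]]; first exact: Nop.1.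
  by rewrite (le_trans (Nop.2 _ Zu))// ler_wpM2r// lerDl.
- move=> N z N's ND [Zz Dz Az]; have Ns := stableW FF' N's.
  have NB := subset_trans ND DB.
  have NPz := fix_in_P Ns NB Zz.
  split; [by case: NPz|by have [] := fix_inS Ns Ds ND DB NPz|].
  (* Let Q be the projection of the intersection of [A] and [N]. Then P_A P_N z = Q P_A P_N z = Q
     P_N z = Q z = Q P_A z = Q 0 = 0. *)
  have [_ <-] := key _ _ N's ND NPz.
  have [-> _] := sk_le sk (stableI As Ns) As (@subIsetl _ A N) AB (sk_sub sk Ns NB Zz).
  have [-> _] := sk_le sk (stableI As Ns) Ns (@subIsetr _ A N) NB Zz.
  have [<- _] := sk_le sk (stableI As Ns) As (@subIsetl _ A N) AB Zz.
  rewrite Az; apply: (op_on0 linZ (sk_op sk (stableI As Ns) _)).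
  by move=> x [/AB].
- move=> N N' z N's N''s NN' N'D [Zz _ _].
  exact: (sk_le sk (stableW FF' N's) (stableW FF' N''s) NN' (subset_trans N'D DB)).
- by move=> z [].
- move=> s n Dsm; have [] := fixB D (q s n) F'D (@subset_refl _ D) => //.
  by split; [exact/(sk_gen sk)/DB|exact: (sk_fix sk)].
- move=> N s n N's ND Nsm; have [] := fixB N (q s n) N's ND => //.
  split; first exact/(sk_gen sk)/DB/ND.
  by apply: (sk_fix sk) => //; [exact: stableW N's|exact: subset_trans DB].
- move=> N z N's ND [Zz Dz Az] Nz; have Ns := stableW FF' N's.
  have NB := subset_trans ND DB.
  have fop : op_on Z (k + 1) (fun u => P A u - u) by exact: op_on_fixB.
  (* Since P_A z = 0, the operator 1 - P_A fixes z. It turns an approximation of z by the [q s n]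
     into one by the [q' s n], at the cost of a factor k + 1. *)
  apply/closure_normP => e e0.
  have k1 : 0 < k + 1 by rewrite ltr_wpDl// (sk_const sk).
  have [y Ny zy] := clspan_approx (sk_span sk Ns NB Zz Nz) (divr_gt0 e0 k1).
  have subK : lin_span (span_of q N) `<=`
      [set y | Z y /\ lin_span (span_of q' N) (y - P A y)].
    have linS := lin_set_span (span_of q' N).
    apply: lin_span_min; first split.
    - split; first exact: linZ.1.
      by rewrite (op_on0 linZ (sk_op sk As AB)) subrr; exact: linS.1.
    - move=> a u v [Zu uP] [Zv vP]; split; first exact: linZ.2.
      rewrite (sk_op sk As AB).1// opprD addrACA -scalerBr.
      exact: linS.2.
    - move=> _ [s [n [Nsm ->]]]; split; first exact/(sk_gen sk)/NB.
      by apply: sub_lin_span; exists s, n.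
  have [Zy yP] := subK _ Ny.
  exists (y - P A y) => //.
  have -> : z - (y - P A y) = - (P A (z - y) - (z - y)).
    rewrite (op_onB (sk_op sk As AB))// Az sub0r.
    by rewrite [in RHS]opprB opprK opprB addrA addrAC.
  rewrite normrN (le_lt_trans (fop.2 _ (lin_setB linZ Zz Zy)))//.
  by rewrite mulrC -ltr_pdivlMr.
Qed.

End facts.
End skeletal.

(** * Markushevich bases *)

Section mbasis.
Context {R : realType} {Y : normedModType R}.
Implicit Types (Z : set Y) (b : set (Y * (Y -> R^o))).

(** Vectors and functionals are kept together in a set of pairs, and the functionals are controlled
    on [Z] only; bases of different pieces can then simply be united. *)
Definition mbasis_on Z b := [/\
  forall p, b p -> Z p.1 /\ exists k, op_on Z k p.2,
  forall p, b p -> p.2 p.1 = 1,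
  forall p p', b p -> b p' -> p <> p' -> p.2 p'.1 = 0,
  Z `<=` clspan (fst @` b) &
  forall u, Z u -> (forall p, b p -> p.2 u = 0) -> u = 0].

Definition ratcomb (s : seq (rat * Y)) : Y := \sum_(p <- s) ratr p.1 *: p.2.

Lemma rat_approx (a e : R) : 0 < e -> exists r : rat, `|a - ratr r| < e.
Proof.
move=> e0; have [r] : exists r : rat, ratr r \in `]a - e, a + e[%R.
  by apply: rat_in_itvoo; rewrite ltrBlDr -addrA ltrDl addr_gt0.
by rewrite in_itv/= => /andP[h1 h2]; exists r; rewrite distrC ltr_distl h1.
Qed.

Lemma ratcomb_approx (W : set Y) x e : lin_span W x -> 0 < e ->
  exists s, (forall p, p \in s -> W p.2) /\ `|x - ratcomb s| < e.
Proof.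
move=> [n [a [w [wW ->]]]].
elim: n a w wW e => [|n IH] a w wW e e0.
  exists [::]; split=> //; by rewrite big_ord0 /ratcomb big_nil subrr normr0.
have e2 : 0 < e / 2 by rewrite divr_gt0.
have [s [sW se]] := IH (a \o lift ord0) (w \o lift ord0)
  (fun i => wW (lift ord0 i)) _ e2.
have w1 : 0 < `|w ord0| + 1 by rewrite ltr_wpDl.
have [r re] := rat_approx (a ord0) (divr_gt0 e2 w1).
exists ((r, w ord0) :: s); split=> [p|].
  by rewrite inE => /predU1P[->|]; [exact: wW|exact: sW].
rewrite big_ord_recl /ratcomb big_cons/= opprD addrACA -scalerBl.
rewrite (le_lt_trans (ler_normD _ _))// [ltRHS]splitr ler_ltD//.
rewrite normrZ; move: re; rewrite ltr_pdivlMr// => /ltW; apply: le_trans.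
by rewrite ler_wpM2l// lerDl.
Qed.

(** Plays the part of Hahn-Banach, up to the factor 2. In F(M) the definition of the dual norm
    supplies such functionals ([norming_lipfree]). *)
Definition norming := forall y : Y, exists f : Y -> R^o,
  op_on [set: Y] 1 f /\ `|y| <= 2 * `|f y|.

(** One half-norming functional is taken for each rational combination of [W]. A vector killed by
    all of them lies within e of such a combination, whose norm is then at most 2 e; hence the
    constant 3. *)
Lemma countable_seqsep Z W : norming -> countable W -> Z `<=` clspan W ->
  exists f : nat -> Y -> R^o, (forall n, op_on [set: Y] 1 (f n)) /\
    forall u, Z u -> (forall n, f n u = 0) -> u = 0.
Proof.
move=> nrm cW ZW; have [w [j [_ wj]]] := countable_enum (0 : Y) cW.
have /choice[f fP] n := nrm (ratcomb [seq (p.1, w p.2) | p <-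
  odflt [::] (unpickle n : option (seq (rat * nat)))]).
exists f; split=> [n|u Zu fu]; first exact: (fP n).1.
apply: (@norm_small_eq0 _ _ _ 3) => e e0.
have e2 : 0 < e / 2 by rewrite divr_gt0.
have [y Wy uy] := clspan_approx (ZW _ Zu) e2.
have [s [sW ys]] := ratcomb_approx Wy e2.
have us : `|u - ratcomb s| < e.
  by rewrite (le_lt_trans (ler_distD y _ _))// [ltRHS]splitr ltrD.
pose n := pickle [seq (p.1, j p.2) | p <- s].
have [fop] := fP n; rewrite /n pickleK /= -map_comp.
have -> : [seq ((fun p => (p.1, w p.2)) \o (fun p => (p.1, j p.2))) p | p <- s] = s.
  rewrite -[RHS]map_id; apply/eq_in_map => -[r v] /sW /= Wv.
  by rewrite wj.
move=> sf; have : `|ratcomb s| <= 2 * e.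
  rewrite (le_trans sf)// ler_wpM2l// -normrN -[- _]add0r -(fu n).
  rewrite -(op_onB fop)// (le_trans (fop.2 _ I))// mul1r; exact: ltW.
move=> se; rewrite -[u](subrK (ratcomb s)) (le_trans (ler_normD _ _))//.
by rewrite (_ : 3 = 1 + 2) ?natr1E// mulrDl mul1r lerD// ltW.
Qed.

Definition bdd (f : Y -> R^o) := exists k, op_on [set: Y] k f.

Lemma bdd0 : bdd (fun=> 0).
Proof.
exists 0; split=> [a u v _ _|u _]; first by rewrite scaler0 addr0.
by rewrite normr0 mul0r.
Qed.

Lemma bdd_lin (a : R) f g : bdd f -> bdd g -> bdd (fun u => a *: f u + g u).
Proof. by move=> [k kf] [l lg]; exists (`|a| * k + l); exact: op_on_lin. Qed.

Lemma bdd_sum (I : Type) (r : seq I) (c : I -> R) (f : I -> Y -> R^o) :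
  (forall i, bdd (f i)) -> bdd (fun u => \sum_(i <- r) c i *: f i u).
Proof.
move=> fb; elim: r => [|i r IH].
  have [k kP] := bdd0.
  by exists k; congr (op_on _ _ _) : kP; apply/funext => u; rewrite big_nil.
have [k kP] := bdd_lin (c i) (fb i) IH.
exists k; congr (op_on _ _ _) : kP; apply/funext => u; by rewrite big_cons.
Qed.

Section gram_schmidt.
Variables (Z : set Y) (linZ : lin_set Z).

Definition biorth (L : seq (Y * (Y -> R^o))) := [/\ uniq L,
  forall p, p \in L -> Z p.1 /\ bdd p.2,
  forall p, p \in L -> p.2 p.1 = 1 &
  forall p p', p \in L -> p' \in L -> p <> p' -> p.2 p'.1 = 0].

Lemma bdd_sumr (I : eqType) (r : seq I) (c : I -> R) (x : I -> Y) f : bdd f ->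
  f (\sum_(i <- r) c i *: x i) = \sum_(i <- r) c i *: f (x i).
Proof.
move=> [k fop]; have f0 := op_on0 (lin_setT) fop.
elim: r => [|i r IH]; first by rewrite !big_nil.
by rewrite !big_cons fop.1// IH.
Qed.

Lemma biorth_coord L (c : Y * (Y -> R^o) -> R) q : biorth L -> q \in L ->
  \sum_(p <- L) c p *: q.2 p.1 = c q /\ \sum_(p <- L) c p *: p.2 q.1 = c q.
Proof.
move=> [uL _ L1 L0] qL; split; rewrite (bigD1_seq q)//= L1// [c q *: _]mulr1.
  rewrite big_seq_cond big1 ?addr0// => p /andP[pL pq].
  by rewrite L0 ?scaler0// => /esym/eqP; rewrite (negPf pq).
rewrite big_seq_cond big1 ?addr0// => p /andP[pL pq].
by rewrite L0 ?scaler0// => /eqP; rewrite (negPf pq).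
Qed.

(** Gram-Schmidt on both sides: [x] is [z] minus its expansion along [L], and [g] is [f] minus its
    dual expansion, divided by [f x]. Thus [z] enters the span of the vectors and [f] that of the
    functionals. *)
Lemma biorth_extend L z f : biorth L -> Z z -> bdd f ->
  f (z - \sum_(p <- L) p.2 z *: p.1) <> 0 ->
  exists x g, [/\ biorth ((x, g) :: L),
    lin_span (fst @` [set` (x, g) :: L]) z &
    forall u, (forall p, p \in (x, g) :: L -> p.2 u = 0) -> f u = 0].
Proof.
move=> bL Zz bf; set x := z - _ => fx.
have [uL LZ L1 L0] := bL.
have Zx : Z x.
  apply: lin_setB => //; rewrite big_seq_cond; apply: lin_set_sum => // p.
  by rewrite andbT => /LZ[Zp _]; exact: lin_setZ.
have Lx q : q \in L -> q.2 x = 0.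
  move=> qL; have [_ [k qop]] := LZ _ qL.
  rewrite /x (op_onB qop)// bdd_sumr; last by exists k.
  by rewrite (biorth_coord (fun p => p.2 z) bL qL).1 subrr.
pose h u : R := f u - \sum_(p <- L) f p.1 *: p.2 u.
have hx : h x = f x.
  by rewrite /h big_seq_cond big1 ?subr0// => p /andP[pL _]; rewrite Lx// scaler0.
have hL q : q \in L -> h q.1 = 0.
  move=> qL; rewrite /h (biorth_coord (fun p => f p.1) bL qL).2.
  by rewrite subrr.
have bh : bdd (h : Y -> R^o).
  pose G p : Y -> R^o := if p \in L then p.2 else fun=> 0.
  have bG p : bdd (G p).
    by rewrite /G; case: ifP => [/LZ[]//|_]; exact: bdd0.
  have [k kP] := bdd_lin (-1) (bdd_sum L (fun p => f p.1) bG) bf.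
  exists k; congr (op_on _ _ _) : kP; apply/funext => u.
  rewrite scaleN1r addrC /h; congr (_ - _); apply: eq_big_seq => p pL.
  by rewrite /G pL.
pose g u : R^o := (f x)^-1 *: (h u : R^o).
have bg : bdd g.
  have [k kP] := bdd_lin (f x)^-1 bh bdd0.
  by exists k; congr (op_on _ _ _) : kP; apply/funext => u; rewrite addr0.
have fx0 : f x != 0 by exact/eqP.
have gx : g x = 1 by rewrite /g hx [LHS]mulVf.
have gL q : q \in L -> g q.1 = 0 by move=> qL; rewrite /g hL// scaler0.
exists x, g; split.
- split=> [|p|p|p p'].
  + rewrite /= uL andbT; apply/negP => xL.
    by have := Lx _ xL; rewrite /= gx => /eqP; rewrite oner_eq0.
  + by rewrite inE => /predU1P[->|/LZ].
  + by rewrite inE => /predU1P[->|/L1].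
  + rewrite !inE => /predU1P[->|pL] /predU1P[->|p'L]//= pp'.
    * exact: gL.
    * exact: Lx.
    * exact: L0.
- have linS := lin_set_span (fst @` [set` (x, g) :: L]).
  rewrite -[z](subrK (\sum_(p <- L) p.2 z *: p.1)).
  apply: lin_setD => //.
    by apply: sub_lin_span; exists (x, g) => //=; rewrite inE eqxx.
  rewrite big_seq_cond; apply: lin_set_sum => // p; rewrite andbT => pL.
  apply: lin_setZ => //; apply: sub_lin_span; exists p => //=.
  by rewrite inE pL orbT.
- move=> u uP; have := uP (x, g); rewrite inE eqxx => /(_ isT)/= /eqP.
  rewrite scaler_eq0 invr_eq0 (negPf fx0)/= /h big_seq_cond big1 ?subr0 => [/eqP//|].
  by move=> p /andP[pL _]; rewrite uP ?scaler0// inE pL orbT.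
Qed.

(** First [z] is absorbed, with a functional that does not vanish on its remainder. If [f] is then
    still not determined by the functionals, some [u] in [Z] killed by them has [f u] nonzero, and
    extending along [u] absorbs [f]. *)
Lemma biorth_step L z f : norming -> biorth L -> Z z -> bdd f ->
  exists L', [/\ biorth L', {subset L <= L'}, lin_span (fst @` [set` L']) z &
    forall u, Z u -> (forall p, p \in L' -> p.2 u = 0) -> f u = 0].
Proof.
move=> nrm bL Zz bf.
have [L1 [bL1 LL1 L1z]] : exists L1, [/\ biorth L1, {subset L <= L1} &
    lin_span (fst @` [set` L1]) z].
  have [z0|z0] := eqVneq (z - \sum_(p <- L) p.2 z *: p.1) 0.
    exists L; split=> //; rewrite (subr0_eq z0) big_seq_cond.
    have linS := lin_set_span (fst @` [set` L]).
    apply: lin_set_sum => // p; rewrite andbT => pL.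
    by apply: lin_setZ => //; apply: sub_lin_span; exists p.
  have [f' [f'op f'z]] := nrm (z - \sum_(p <- L) p.2 z *: p.1).
  have bf' : bdd f' by exists 1.
  have [|x [g [bL1 L1z _]]] := biorth_extend bL Zz bf'.
    by move=> f'0; move: f'z; rewrite f'0 normr0 mulr0 normr_le0 (negPf z0).
  by exists ((x, g) :: L); split=> // p pL; rewrite inE pL orbT.
have [fL|] := pselect (forall u, Z u -> (forall p, p \in L1 -> p.2 u = 0) -> f u = 0).
  by exists L1.
move=> /existsNP[u /not_implyP[Zu /not_implyP[uL1 fu]]].
have [|x [g [bL2 _ L2f]]] := biorth_extend bL1 Zu bf.
  rewrite big_seq_cond big1 ?subr0// => p /andP[pL _].
  by rewrite uL1// scale0r.
exists ((x, g) :: L1); split=> //.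
- by move=> p pL; rewrite inE LL1 ?orbT.
- apply: (lin_span_min (lin_set_span _)) L1z => _ [p pL <-].
  by apply: sub_lin_span; exists p => //=; rewrite inE; apply/orP; right.
- by move=> v _; exact: L2f.
Qed.

(** Markushevich's argument: step n absorbs the n-th vector of a sequence with dense span and the
    n-th functional of a separating sequence. The union of the finite systems is the basis. *)
Lemma markushevich W : norming -> countable W -> W `<=` Z -> Z `<=` clspan W ->
  exists b, mbasis_on Z b.
Proof.
move=> nrm cW WZ ZW.
have [f [fop fsep]] := countable_seqsep nrm cW ZW.
have [w [j [wW wj]]] := countable_enum (0 : Y) cW.
have wZ n : Z (w n) by have [->|/WZ//] := wW n; exact: linZ.1.
have bf n : bdd (f n) by exists 1.
have /choice[nxt nxtP] (nL : nat * {L | biorth L}) : exists L' : {L | biorth L},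
    [/\ {subset sval nL.2 <= sval L'},
      lin_span (fst @` [set` sval L']) (w nL.1) &
      forall u, Z u -> (forall p, p \in sval L' -> p.2 u = 0) -> f nL.1 u = 0].
  have [L' [bL' sL' zL' fL']] := biorth_step nrm (svalP nL.2) (wZ nL.1) (bf nL.1).
  by exists (exist _ L' bL').
have b0 : biorth [::] by [].
pose L := fix L n := if n is m.+1 then nxt (m, L m) else exist _ [::] b0.
have Lmono m n : (m <= n)%N -> {subset sval (L m) <= sval (L n)}.
  elim: n => [|n IH]; first by rewrite leqn0 => /eqP ->.
  rewrite leq_eqVlt => /predU1P[->//|/IH mn] p /mn.
  by have [h _ _] := nxtP (n, L n); exact: h.
exists [set p | exists n, p \in sval (L n)]; split.
- by move=> p [n pL]; have [_ /(_ _ pL)[Zp [k [kl kb]]] _ _] := svalP (L n);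
    split=> //; exists k; split=> [a u v _ _|u _]; [exact: kl|exact: kb].
- by move=> p [n pL]; have [_ _ + _] := svalP (L n); exact.
- move=> p p' [m pL] [n p'L]; have [_ _ _] := svalP (L (maxn m n)); apply.
    by apply: Lmono pL; exact: leq_maxl.
  by apply: Lmono p'L; exact: leq_maxr.
- apply: subset_trans ZW _; apply: clspan_sub => y Wy; rewrite -(wj _ Wy).
  have [_ h _] := nxtP (j y, L (j y)); apply: subset_closure.
  apply: (lin_span_min (lin_set_span _)) h => _ [p pL <-].
  by apply: sub_lin_span; exists p => //; exists (j y).+1.
- move=> u Zu uL; apply: fsep => // n.
  have [_ _] := nxtP (n, L n); apply=> // p pL.
  by apply: uL; exists n.+1.
Qed.

End gram_schmidt.
End mbasis.

(** * Gluing bases along a well-order *)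

Section induction.
Context {R : realType} {Y : normedModType R} {S W : Type}.
Variables (lt : W -> W -> Prop).
Hypothesis lt_wf : well_founded lt.
Hypothesis lt_trans : forall x y z, lt x y -> lt y z -> lt x z.
Hypothesis lt_total : forall x y, x = y \/ lt x y \/ lt y x.

Definition below x : set W := [set y | lt y x].
Definition upto x : set W := [set y | y = x \/ lt y x].

Lemma below_upto x : below x `<=` upto x.
Proof. by move=> y; right. Qed.

Lemma upto_below x y : lt x y -> upto x `<=` below y.
Proof. by move=> xy z [->//|zx]; exact: lt_trans xy. Qed.

Definition down_closed (E : set W) := forall x y, E x -> lt y x -> E y.

Lemma down_closed_below x : down_closed (below x).
Proof. by move=> y z yx zy; exact: lt_trans yx. Qed.

Section chain.
Variables (Z : set Y) (B : set S) (F : S -> S -> set S).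
Variables (P : set S -> Y -> Y) (q : S -> nat -> Y) (k : R).
Variables (s : W -> S) (E : set W).
Hypothesis sk : skeletal Z B F P q k.
Hypothesis E_down : down_closed E.
Hypothesis B_gen : B = gen F (s @` E).
Hypothesis pieces : forall x, E x -> forall Z' F' q' k',
  skeletal Z' (gen F' (s @` upto x)) F' P q' k' -> exists b, mbasis_on Z' b.

Let D x := gen F (s @` upto x).
Let C x := gen F (s @` below x).

Let genSI (A A' : set W) : A `<=` A' -> gen F (s @` A) `<=` gen F (s @` A').
Proof. by move=> AA'; apply: genS; exact: image_subset. Qed.

Let Dst x : stable F (D x). Proof. exact: stable_gen. Qed.
Let Cst x : stable F (C x). Proof. exact: stable_gen. Qed.
Let CD x : C x `<=` D x. Proof. apply: genSI; exact: below_upto. Qed.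

Let DB x : E x -> D x `<=` B.
Proof.
move=> Ex; rewrite B_gen; apply: genSI => y [->//|yx].
exact: E_down yx.
Qed.

Let CB x : E x -> C x `<=` B.
Proof. by move=> /DB; exact: subset_trans. Qed.

Let DC x y : lt x y -> D x `<=` C y.
Proof. by move=> xy; apply: genSI; exact: upto_below. Qed.

Let DD x y : lt x y -> D x `<=` D y.
Proof. by move=> /DC; move=> h; exact: subset_trans (@CD _). Qed.

(** What the index x adds to those strictly before it; [pi x] is the projection onto this piece. *)
Let piece x := [set z | [/\ Z z, P (D x) z = z & P (C x) z = 0]].
Let pi x z := P (D x) z - P (C x) z.

Let piece_basis x : E x -> exists b, mbasis_on (piece x) b.
Proof.
move=> Ex.
have [F' [q' [k' [FF' sk' F'D]]]] :=
  skeletal_refine sk (@Cst x) (@Dst x) (@CD x) (DB Ex).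
apply: (pieces Ex (F' := F') (q' := q') (k' := k')).
(* [D x] is stable under [F'] too, so it is also the set that [F'] generates, as [pieces]
   demands. *)
suff -> : gen F' (s @` upto x) = D x by [].
apply/seteqP; split; first by apply: gen_min; [exact: F'D|exact: sub_gen].
apply: gen_min; last exact: sub_gen.
apply: (stableW FF'); exact: stable_gen.
Qed.

Let pi_piece x z : E x -> Z z -> piece x (pi x z).
Proof.
move=> Ex Zz; have linZ := sk_lin sk.
have Dop := sk_op sk (@Dst x) (DB Ex); have Cop := sk_op sk (@Cst x) (CB Ex).
have ZD := sk_sub sk (@Dst x) (DB Ex) Zz.
have ZC := sk_sub sk (@Cst x) (CB Ex) Zz.
split; first exact: lin_setB.
  rewrite (op_onB Dop)//.
  have [_ ->] := sk_le sk (@Dst x) (@Dst x) (@subset_refl _ _) (DB Ex) Zz.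
  by have [_ ->] := sk_le sk (@Cst x) (@Dst x) (@CD x) (DB Ex) Zz.
rewrite (op_onB Cop)//.
have [-> _] := sk_le sk (@Cst x) (@Dst x) (@CD x) (DB Ex) Zz.
have [-> _] := sk_le sk (@Cst x) (@Cst x) (@subset_refl _ _) (CB Ex) Zz.
by rewrite subrr.
Qed.

Let pi_id x z : piece x z -> pi x z = z.
Proof. by move=> [_ Dz Cz]; rewrite /pi Dz Cz subr0. Qed.

(** On the piece of y, both projections in [pi x] vanish if x is before y, and both are the identity
    if x is after y. *)
Let pi_orth x y z : E x -> E y -> x <> y -> piece y z -> pi x z = 0.
Proof.
move=> Ex Ey xy [Zz Dz Cz]; rewrite /pi.
have [//|[lxy|lyx]] := lt_total x y.
  have linZ := sk_lin sk.
  have PDz : P (D x) z = 0.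
    have [<- _] := sk_le sk (@Dst x) (@Cst y) (DC lxy) (CB Ey) Zz.
    by rewrite Cz (op_on0 linZ (sk_op sk (@Dst x) (DB Ex))).
  have [<- _] := sk_le sk (@Cst x) (@Dst x) (@CD x) (DB Ex) Zz.
  by rewrite PDz (op_on0 linZ (sk_op sk (@Cst x) (CB Ex))) subrr.
have Dzz : P (C x) z = z.
  rewrite -{1}Dz.
  by have [_ ->] := sk_le sk (@Dst y) (@Cst x) (DC lyx) (CB Ex) Zz.
rewrite Dzz -{1}Dz.
have [_ ->] := sk_le sk (@Dst y) (@Dst x) (DD lyx) (DB Ex) Zz.
by rewrite Dz subrr.
Qed.

(** A union of a chain of stable sets is stable, because two arguments of [F] always lie in a common
    member. *)
Let gen_union (E' : set W) : E' `<=` E -> down_closed E' ->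
  gen F (s @` E') `<=` \bigcup_(x in E') D x.
Proof.
move=> E'E dE'; apply: gen_min => [a b [x Ex Da] [y Ey Db] c Fc|].
  have [xy|[xy|yx]] := lt_total x y.
  - by exists x => //; apply: (Dst Da _ Fc); rewrite xy.
  - by exists y => //; apply: (Dst (DD xy Da) Db Fc).
  - by exists x => //; apply: (Dst Da (DD yx Db) Fc).
by move=> _ [x Ex <-]; exists x => //; apply: sub_gen; exists x => //; left.
Qed.

Let genE' (E' : set W) : E' `<=` E -> gen F (s @` E') `<=` B.
Proof. by move=> E'E; rewrite B_gen; exact: genSI. Qed.

(** P_A u is approximated by vectors y, each fixed by a single P_{D x}. As P_{D x} P_A u = P_{D x} u
    = 0, one has y = P_{D x} (y - P_A u), so y is small and P_A u with it. *)
Let limit_ker (E' : set W) u : E' `<=` E -> down_closed E' -> Z u ->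
  (forall x, E' x -> P (D x) u = 0) -> P (gen F (s @` E')) u = 0.
Proof.
move=> E'E dE' Zu Pu; set A := gen _ _.
have Ast : stable F A by exact: stable_gen.
have AB := genE' E'E; have linZ := sk_lin sk.
have [ZA AA] := fix_in_P sk Ast AB Zu.
have sub : lin_span (span_of q A) `<=`
    [set y | y = 0 \/ exists x, E' x /\ fix_in Z P (D x) y].
  apply: lin_span_min => [|y [a [n [/(gen_union E'E dE')[x Ex Dxa] ->]]]]; last first.
    right; exists x; split=> //.
    by apply: (span_of_fix sk (@Dst x) (DB (E'E _ Ex)) (@subset_refl _ _)); exists a, n.
  have fl x : E' x -> lin_set (fix_in Z P (D x)).
    by move=> /E'E/DB; exact: (fix_in_lin sk (@Dst x)).
  split=> [|c y z]; first by left.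
  case=> [->|[x [Ex Dy]]] [->|[x' [Ex' Dz]]].
  - by left; rewrite scaler0 addr0.
  - by right; exists x'; rewrite scaler0 add0r.
  - right; exists x; split=> //; rewrite addr0; exact: (lin_setZ _ (fl _ Ex)).
  - have up y1 y2 v : E' y1 -> E' y2 -> lt y1 y2 -> fix_in Z P (D y1) v ->
        fix_in Z P (D y2) v.
      by move=> _ /E'E/DB h /DD; move/(fix_inS sk (@Dst _) (@Dst _))/(_ h); exact.
    have [xx|[xx|xx]] := lt_total x x'.
    + by right; exists x; split=> //; apply: (fl _ Ex).2; rewrite // xx.
    + by right; exists x'; split=> //; apply: (fl _ Ex').2 => //; exact: up Dy.
    + by right; exists x; split=> //; apply: (fl _ Ex).2 => //; exact: up Dz.
apply: (@norm_small_eq0 _ _ _ (k + 1)) => e e0.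
have [y Ay ye] := clspan_approx (sk_span sk Ast AB ZA AA) e0.
have k1 : 1 <= k + 1 by rewrite lerDr (sk_const sk).
have [y0|[x [Ex [Zy Dy]]]] := sub _ Ay.
  move: ye; rewrite y0 subr0 => /ltW; move=> h; rewrite (le_trans h)//.
  by rewrite ler_peMl// ltW.
have Dop := sk_op sk (@Dst x) (DB (E'E _ Ex)).
have yE : y = P (D x) (y - P A u).
  rewrite (op_onB Dop)// Dy.
  have -> : P (D x) (P A u) = 0; last by rewrite subr0.
  have DA : D x `<=` A by apply: genSI => z [->//|zx]; exact: dE' zx.
  by have [-> _] := sk_le sk (@Dst x) Ast DA AB Zu; exact: Pu.
rewrite -[P A u](subrK y) addrC (le_trans (ler_normD _ _))// mulrDl mul1r.
rewrite lerD//; last exact: ltW.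
rewrite yE (le_trans (Dop.2 _ (lin_setB linZ Zy ZA)))// ler_wpM2l ?(sk_const sk)//.
by rewrite distrC ltW.
Qed.

Let limit_span (E' : set W) (V : set Y) : E' `<=` E -> down_closed E' ->
  (forall x, E' x -> fix_in Z P (D x) `<=` clspan V) ->
  fix_in Z P (gen F (s @` E')) `<=` clspan V.
Proof.
move=> E'E dE' DV z [Zz Az].
apply: (@clspan_sub _ _ (span_of q (gen F (s @` E')))).
  move=> y [a [n [/(gen_union E'E dE')[x Ex Dxa] ->]]]; apply: (DV _ Ex).
  by apply: (span_of_fix sk (@Dst x) (DB (E'E _ Ex)) (@subset_refl _ _)); exists a, n.
by apply: (sk_span sk _ (genE' E'E) Zz Az); exact: stable_gen.
Qed.

Let below_E x : E x -> below x `<=` E.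
Proof. by move=> Ex y yx; exact: E_down yx. Qed.

(** Functionals of a piece are extended to [Z] by composition with [pi x]. Spanning and separation
    both follow by well-founded induction from P_{D x} = [pi x] + P_{C x}, the term P_{C x} being
    reached as a limit of earlier stages. *)
Lemma mbasis_chain : exists b, mbasis_on Z b.
Proof.
have linZ := sk_lin sk.
have /choice[b bP] x : exists b, E x -> mbasis_on (piece x) b.
  have [/piece_basis[b bP]|nEx] := pselect (E x); first by exists b.
  by exists set0.
have Bst := sk_index sk.
have piop x : E x -> op_on Z (k + k) (pi x).
  move=> Ex; have Dop := sk_op sk (@Dst x) (DB Ex).
  have Cop := sk_op sk (@Cst x) (CB Ex).
  split=> [a u v Zu Zv|u Zu].
    by rewrite /pi Dop.1// Cop.1// scalerBr opprD addrACA.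
  by rewrite (le_trans (ler_normB _ _))// mulrDl lerD ?Dop.2 ?Cop.2.
exists [set p | exists x v, [/\ E x, b x v & p = (v.1, v.2 \o pi x)]].
split.
- move=> _ [x [v [Ex bv ->]]]; have [bZ _ _ _ _] := bP x Ex.
  have [[Zv _ _] [l lop]] := bZ _ bv; split=> //=.
  exists (`|l| * (k + k)); apply: (op_on_comp (Z' := piece x)) => //.
  + exact: piop.
  + by move=> u; exact: pi_piece.
  + split; first exact: lop.1.
    by move=> u /lop.2 h; rewrite (le_trans h)// ler_wpM2r// ler_norm.
- move=> _ [x [v [Ex bv ->]]] /=; have [bZ b1 _ _ _] := bP x Ex.
  by rewrite pi_id ?b1//; exact: (bZ _ bv).1.
- move=> _ _ [x [v [Ex bv ->]]] [x' [v' [Ex' bv' ->]]] /= vv'.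
  have [bZ _ b0 _ _] := bP x Ex; have [bZ' _ _ _ _] := bP x' Ex'.
  have [xx|xx] := pselect (x = x').
    subst x'; rewrite pi_id; last exact: (bZ' _ bv').1.
    by apply: b0 => // vE; apply: vv'; rewrite vE.
  rewrite (pi_orth Ex Ex')//; last exact: (bZ' _ bv').1.
  have [_ [l lop]] := bZ _ bv.
  apply: (op_on0 _ lop); split.
    split; [exact: linZ.1| |].
      by rewrite (op_on0 linZ (sk_op sk (@Dst x) (DB Ex))).
    by rewrite (op_on0 linZ (sk_op sk (@Cst x) (CB Ex))).
  move=> a u w [Zu Du Cu] [Zw Dw Cw]; split; first exact: linZ.2.
    by rewrite (sk_op sk (@Dst x) (DB Ex)).1// Du Dw.
  by rewrite (sk_op sk (@Cst x) (CB Ex)).1// Cu Cw scaler0 addr0.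
- set V := fst @` _.
  have VD x : E x -> fix_in Z P (D x) `<=` clspan V.
    elim: (lt_wf x) => {}x _ IH Ex z [Zz Dz].
    rewrite -Dz -[P _ _](subrK (P (C x) z)).
    apply: (lin_setD (lin_set_clspan V)).
      have [_ _ _ bspan _] := bP x Ex.
      apply: clspanS (bspan _ (pi_piece Ex Zz)) => _ [v bv <-].
      by exists (v.1, v.2 \o pi x) => //; exists x, v.
    apply: (limit_span (E' := below x)) => //.
    + exact: below_E.
    + exact: down_closed_below.
    + by move=> y yx; apply: IH => //; exact: E_down yx.
    + exact: (fix_in_P sk (@Cst x) (CB Ex)).
  have := limit_span (@subset_refl _ E) E_down VD; rewrite -B_gen => h z Zz.
  by apply: h; split=> //; exact: (sk_id sk).
- move=> u Zu ub.
  have PD x : E x -> P (D x) u = 0.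
    elim: (lt_wf x) => {}x _ IH Ex.
    have PC : P (C x) u = 0.
      apply: limit_ker => //; first exact: below_E.
        exact: down_closed_below.
      by move=> y yx; apply: IH => //; exact: E_down yx.
    have [_ _ _ _ bsep] := bP x Ex.
    have := bsep _ (pi_piece Ex Zu); rewrite /pi PC subr0; apply=> v bv.
    have /= := ub (v.1, v.2 \o pi x); rewrite /pi PC subr0; apply.
    by exists x, v.
  have := limit_ker (@subset_refl _ E) E_down Zu PD.
  by rewrite -B_gen (sk_id sk).
Qed.

End chain.

Hypothesis nrm : @norming R Y.

Lemma mbasis_countable Z B F P q k : @skeletal R Y S Z B F P q k -> countable B ->
  exists b, mbasis_on Z b.
Proof.
move=> sk cB; apply: (markushevich (sk_lin sk) (W := span_of q B) nrm).
- have -> : span_of q B = (fun p => q p.1 p.2) @` (B `*` [set: nat]).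
    apply/seteqP; split=> [_ [s [n [Bs ->]]]|_ [[s n] [/= Bs _] <-]].
      by exists (s, n).
    by exists s, n.
  have cBn : countable (B `*` [set: nat]) by exact: countableX.
  by apply: sub_countable cBn; exact: card_image_le.
- by move=> _ [s [n [Bs ->]]]; exact: (sk_gen sk).
- by move=> z Zz; apply: (sk_span sk (sk_index sk)) => //; exact: (sk_id sk).
Qed.

(** Hilbert's hotel: shifting along a sequence of distinct points of [A] makes room for [x]. *)
Lemma infinite_reindex (A : set W) x : infinite_set A ->
  exists f : W -> W, f @` A = x |` A.
Proof.
move=> /infiniteP/card_leP/unsquash g.
have [u uA uinj] : exists2 u : nat -> W, forall n, A (u n) & injective u.
  exists (fun n => val (g (SigSub (mem_set (I : [set: nat] n))))) => [n|m n].
    exact: set_valP.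
  by move=> /val_inj/inj; rewrite !inE => /(_ I I)/(congr1 val).
pose f y := if pselect (exists n, y = u n) is left h
  then (if sval (cid h) is m.+1 then u m else x) else y.
have fu n : f (u n) = if n is m.+1 then u m else x.
  rewrite /f; case: pselect => [h|[]]; last by exists n.
  by case: (cid h) => m /= /uinj ->.
exists f; apply/seteqP; split=> [_ [y Ay <-]|y].
  rewrite /f; case: pselect => [h|_]; last by right.
  by case: (cid h) => -[|m] /= _; [left|right; exact: uA].
case=> [->|Ay]; first by exists (u 0%N); [exact: uA|rewrite fu].
have [[n ->]|nu] := pselect (exists n, y = u n).
  by exists (u n.+1); [exact: uA|rewrite fu].
by exists y => //; rewrite /f; case: pselect.
Qed.

(* The generators of an infinite closed segment can be re-indexed by the open  *)
(* segment, so that well-founded induction replaces the usual one on density.  *)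
Lemma mbasis_upto x (s : W -> S) Z F P q k :
  @skeletal R Y S Z (gen F (s @` upto x)) F P q k -> exists b, mbasis_on Z b.
Proof.
elim: (lt_wf x) => {}x _ IH in s Z F P q k * => sk.
have uptoE : upto x = x |` below x by [].
have [fx|ix] := pselect (finite_set (below x)).
  apply: (mbasis_countable sk); apply: countable_gen (sk_countable sk) _.
  by apply/finite_set_countable/finite_image; rewrite uptoE finite_setU.
have [f fE] := infinite_reindex x ix.
have gE : gen F (s @` upto x) = gen F ((s \o f) @` below x).
  by rewrite uptoE -fE image_comp.
apply: (mbasis_chain sk (@down_closed_below x) gE) => y yx Z' F' q' k'.
exact: IH.
Qed.

Lemma mbasis_skeletal (s : W -> S) Z F P q k :
  @skeletal R Y S Z (gen F (range s)) F P q k -> exists b, mbasis_on Z b.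
Proof.
move=> sk; apply: (mbasis_chain sk (s := s) (E := setT)) => //.
by move=> x _ Z' F' q' k'; exact: mbasis_upto.
Qed.

End induction.

(** * Projections along directed sets of a skeleton *)

Section skeleton.
Context {R : realType} (X : normedModType R).
Variables (d : Order.disp_t) (G : porderType d) (P : G -> {linear X -> X}).
Hypothesis skP : projectional_skeleton P.
Implicit Types (s t a b c : G) (x y z : X).

Let ub s t := sval (cid (skeleton_directed skP s t)).
Let ubl s t : (s <= ub s t)%O. Proof. by rewrite /ub; case: cid => u []. Qed.
Let ubr s t : (t <= ub s t)%O. Proof. by rewrite /ub; case: cid => u []. Qed.

Lemma skeleton_fixS s t z : (s <= t)%O -> P s z = z -> P t z = z.
Proof. by move=> st <-; have [_ <-] := skeleton_comm skP st z. Qed.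

Lemma homo_seq_le (a : nat -> G) : (forall n, (a n <= a n.+1)%O) ->
  forall m n, (m <= n)%N -> (a m <= a n)%O.
Proof.
move=> aS m n; elim: n => [|n IH]; first by rewrite leqn0 => /eqP ->.
rewrite leq_eqVlt => /predU1P[->//|/IH h].
exact: Order.POrderTheory.le_trans h (aS n).
Qed.

(** Skeletons give suprema of strictly increasing sequences. This form also covers eventually
    constant ones; all other increasing sequences have a strictly increasing subsequence. *)
Definition weak_sup (a : nat -> G) t := (forall n, (a n <= t)%O) /\
  forall x e, 0 < e -> exists n z, P (a n) z = z /\ `|P t x - z| < e.

Lemma weak_supP (a : nat -> G) : (forall n, (a n <= a n.+1)%O) ->
  exists t, weak_sup a t.
Proof.
move=> aS; have amono := homo_seq_le aS.
have [[N aN]|] := pselect (exists N, forall n, (N <= n)%N -> a n = a N).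
  exists (a N); split=> [n|x e e0].
    have [nN|/ltnW Nn] := leqP n N; first exact: amono.
    by rewrite (aN _ Nn).
  exists N, (P (a N) x); split; first exact: skeleton_proj skP _ _.
  by rewrite subrr normr0.
move=> /forallNP h.
have /choice[phi phiP] N : exists n, (N < n)%N /\ (a N < a n)%O.
  have /existsNP[n /not_implyP[Nn /eqP an]] := h N.
  exists n; split; last by rewrite Order.POrderTheory.lt_neqAle eq_sym an amono.
  by rewrite ltn_neqAle Nn andbT; apply: contra_neq an => ->.
pose g k := iter k phi 0%N.
have gk k : (k <= g k)%N.
  elim: k => [//|k IH]; apply: (leq_ltn_trans IH).
  exact: (phiP (g k)).1.
have gS k : (a (g k) < a (g k.+1))%O by exact: (phiP (g k)).2.
have [t tsup] := skeleton_sup skP gS.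
exists t; have [_ tub _] := tsup; split=> [n|x e e0].
  exact: Order.POrderTheory.le_trans (amono _ _ (gk n)) (tub n).
have : range (P t) (P t x) by exists x.
rewrite (skeleton_continuous skP tsup) => /closure_normP/(_ e e0).
move=> [_ [k _ [y _ <-]] xy]; exists (g k), (P (a (g k)) y).
by split=> //; exact: skeleton_proj skP _ _.
Qed.

Definition bdd_by (C : R) s := forall x, `|P s x| <= C * `|x|.

(** Otherwise choose s_n above which no projection is bounded by n. An index t above all the s_n
    would have an unbounded P t. *)
Lemma skeleton_uniform : exists C, 0 <= C /\
  forall s, exists2 t, (s <= t)%O & bdd_by C t.
Proof.
apply: contrapT => /forallNP h.
have /choice[s sP] (n : nat) : exists s, forall t, (s <= t)%O -> ~ bdd_by n%:R t.
  have := h n%:R; move=> /not_andP[|/existsNP[s sn]]; first by rewrite ler0n.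
  by exists s => t st tn; apply: sn; exists t.
pose a := fix a n := if n is m.+1 then ub (a m) (s m.+1) else s 0%N.
have [t [tub _]] : exists t, weak_sup a t by apply: weak_supP => n; exact: ubl.
have [k kP] := skeleton_bounded skP t.
have st n : (s n <= t)%O.
  by apply: Order.POrderTheory.le_trans (tub n); case: n => [//|n]; exact: ubr.
apply: (sP (Num.truncn `|k|).+1 t) => // x; rewrite (le_trans (kP x))//.
by rewrite ler_wpM2r// (le_trans (ler_norm k))// ltW// truncnS_gt.
Qed.

Section directed_limits.
Variables (C : R).
Hypothesis C0 : 0 <= C.

Lemma weak_sup_cvg (a : nat -> G) t x e : (forall n, (a n <= a n.+1)%O) ->
  (forall n, bdd_by C (a n)) -> weak_sup a t -> 0 < e ->
  exists N, forall n, (N <= n)%N -> `|P (a n) x - P t x| <= (C + 1) * e.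
Proof.
move=> aS aC [tub tapp] e0; have [N [z [Nz ze]]] := tapp x e e0.
exists N => n Nn; have nz := skeleton_fixS (homo_seq_le aS Nn) Nz.
have [-> _] := skeleton_comm skP (tub n) x.
rewrite (le_trans (ler_distD z _ _))// mulrDl mul1r lerD//; last first.
  by rewrite distrC ltW.
rewrite -{1}nz -linearB (le_trans (aC n _))// ler_wpM2l//; exact: ltW.
Qed.

Implicit Types A : set G.

Definition directed_in A := (forall a, A a -> bdd_by C a) /\
  forall a b, A a -> A b -> exists c, [/\ A c, (a <= c)%O & (b <= c)%O].

(** The alternative z = 0 makes {0} the range attached to the empty set of indices. *)
Definition fix_some A z := z = 0 \/ exists2 a, A a & P a z = z.

Definition near_fix A x := forall e, 0 < e -> exists2 z, fix_some A z & `|x - z| < e.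

Lemma near_fixD A x y : directed_in A ->
  near_fix A x -> near_fix A y -> near_fix A (x - y).
Proof.
move=> [_ dA] Ax Ay e e0; have e2 : 0 < e / 2 by rewrite divr_gt0.
have [u Au xu] := Ax _ e2; have [v Av yv] := Ay _ e2.
exists (u - v); last first.
  have -> : x - y - (u - v) = (x - u) - (y - v) by rewrite !opprD addrACA.
  by rewrite (le_lt_trans (ler_normB _ _))// [ltRHS]splitr ltrD.
case: Au => [->|[a Aa au]]; case: Av => [->|[b Ab bv]].
- by left; rewrite subrr.
- by right; exists b => //; rewrite sub0r linearN bv.
- by right; exists a => //; rewrite subr0.
- have [c [Ac ac bc]] := dA _ _ Aa Ab; right; exists c => //.
  by rewrite linearB (skeleton_fixS ac au) (skeleton_fixS bc bv).
Qed.

(** Near x there is z = P a z = P a (z - x) + P a x. The case K = 0 says that a vector in the closed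
    range is determined by its images under the [P a]. *)
Lemma near_fix_bound A x K : directed_in A -> near_fix A x -> 0 <= K ->
  (forall a, A a -> `|P a x| <= K) -> `|x| <= K.
Proof.
move=> [bA _] Ax K0 PK; apply/ler_addgt0Pr => e e0.
have C2 : 0 < C + 1 by rewrite ltr_wpDl.
have d0 : 0 < e / (C + 1) by rewrite divr_gt0.
have [z Az xz] := Ax _ d0.
have zK : `|z| <= C * (e / (C + 1)) + K.
  case: Az => [->|[a Aa <-]].
    by rewrite normr0 addr_ge0// mulr_ge0// ltW.
  rewrite -[z](subrK x) linearD (le_trans (ler_normD _ _))// lerD ?PK//.
  by rewrite (le_trans (bA _ Aa _))// ler_wpM2l// distrC ltW.
rewrite -[x](subrK z) (le_trans (ler_normD _ _))//.
rewrite (le_trans (lerD (ltW xz) zK))// addrA.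
rewrite -{1}[e / _]mul1r -mulrDl [1 + C]addrC mulrC divfK ?gt_eqF//.
by rewrite addrC.
Qed.

(** The net (P a x) is Cauchy, since a failure would produce an increasing sequence contradicting
    [weak_sup_cvg]. The limit is P t x, for t above an increasing sequence in [A] that dominates the
    Cauchy moduli; t itself may lie outside [A]. *)
Lemma directed_limit A x : directed_in A ->
  exists y, near_fix A y /\ forall a, A a -> P a y = P a x.
Proof.
move=> [bA dA].
have [->|/set0P[a0 Aa0]] := eqVneq A set0.
  by exists 0; split=> // e e0; exists 0; [left|rewrite subrr normr0].
have C2 : 0 < C + 1 by rewrite ltr_wpDl.
have cauchy e : 0 < e -> exists a, A a /\
    forall b, A b -> (a <= b)%O -> `|P b x - P a x| <= e.
  move=> e0; apply: contrapT => /forallNP h.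
  have /choice[nxt nxtP] a : exists b, A a ->
      [/\ A b, (a <= b)%O & e < `|P b x - P a x|].
    have [Aa|nAa] := pselect (A a); last by exists a.
    have /not_andP[//|/existsNP[b /not_implyP[Ab /not_implyP[ab /negP]]]] := h a.
    by rewrite -ltNge => be; exists b.
  pose a n := iter n nxt a0.
  have aA n : A (a n).
    by elim: n => [//|n IH]; have [] := nxtP _ IH.
  have aS n : (a n <= a n.+1)%O by have [] := nxtP _ (aA n).
  have [t tsup] := weak_supP aS.
  have d0 : 0 < e / 2 / (C + 1) by rewrite !divr_gt0.
  have [N NP] := weak_sup_cvg x aS (fun n => bA _ (aA n)) tsup d0.
  have [_ _] := nxtP _ (aA N); apply/negP; rewrite -leNgt.
  have Ce : (C + 1) * (e / 2 / (C + 1)) = e / 2.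
    by rewrite mulrC divfK// gt_eqF.
  rewrite Ce in NP.
  rewrite (le_trans (ler_distD (P t x) _ _))// [leRHS]splitr lerD//.
    exact: (NP N.+1).
  by rewrite distrC NP.
have /choice[c cP] (n : nat) : exists a, A a /\
    forall b, A b -> (a <= b)%O -> `|P b x - P a x| <= n.+1%:R^-1.
  exact: cauchy.
have /choice[u uP] (p : G * G) : exists c, A p.1 -> A p.2 ->
    [/\ A c, (p.1 <= c)%O & (p.2 <= c)%O].
  have [[A1 A2]|nA] := pselect (A p.1 /\ A p.2).
    by have [c' c'P] := dA _ _ A1 A2; exists c'.
  by exists a0 => A1 A2; case: nA.
pose a := fix a n := if n is m.+1 then u (a m, c m.+1) else c 0%N.
have aA n : A (a n).
  elim: n => [|n IH]; first exact: (cP 0%N).1.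
  by have [] := uP (a n, c n.+1) IH (cP n.+1).1.
have aS n : (a n <= a n.+1)%O.
  by have [] := uP (a n, c n.+1) (aA n) (cP n.+1).1.
have ca n : (c n <= a n)%O.
  case: n => [|n]; first exact: Order.POrderTheory.lexx.
  by have [] := uP (a n, c n.+1) (aA n) (cP n.+1).1.
have [t tsup] := weak_supP aS; exists (P t x); split.
  move=> e e0; have [n [z [nz ze]]] := tsup.2 x e e0.
  by exists z => //; right; exists (a n).
(* Inside C + 3, the part C + 1 comes from the convergence to P t x and 2 from two uses of the
   Cauchy modulus. *)
move=> b Ab; apply/subr0_eq/(@norm_small_eq0 _ _ _ (C * (C + 3))) => e e0.
have [n ne] := natSinv_lt e0.
have [N NP] := weak_sup_cvg x aS (fun n => bA _ (aA n)) tsup e0.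
pose m := maxn n N.
have me : m.+1%:R^-1 <= e.
  rewrite (le_trans _ (ltW ne))// lef_pV2 ?posrE// ler_nat ltnS.
  exact: leq_maxl.
have [f [Af af bf]] := dA _ _ (aA m) Ab.
have [-> _] := skeleton_comm skP bf x.
rewrite -linearB (le_trans (bA _ Ab _))// -mulrA ler_wpM2l//.
rewrite (le_trans (ler_distD (P (a m) x) _ _))//.
have h1 : `|P t x - P (a m) x| <= (C + 1) * e.
  by rewrite distrC NP// leq_maxr.
have h2 : `|P (a m) x - P f x| <= e + e.
  rewrite (le_trans (ler_distD (P (c m) x) _ _))// lerD//.
    by rewrite (le_trans ((cP m).2 _ (aA m) (ca m)))//.
  rewrite distrC (le_trans ((cP m).2 _ Af _))//.
  exact: Order.POrderTheory.le_trans (ca m) af.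
rewrite (le_trans (lerD h1 h2))// le_eqVlt; apply/orP; left; apply/eqP.
by rewrite -mulr2n -[e *+ 2]mulr_natl -mulrDl -addrA -natr1E.
Qed.

Lemma near_fixS A A' x : A `<=` A' -> near_fix A x -> near_fix A' x.
Proof.
move=> AA' Ax e e0; have [z Az xz] := Ax e e0; exists z => //.
by case: Az => [->|[a /AA' Aa az]]; [left|right; exists a].
Qed.

(** [p A x] is the only vector of the closed range of [A] with the same images as x under all [P a];
    every clause follows from this. A Lipschitz bound is all that the passage to F(X) asks for. *)
Lemma directed_projections (B_family : set (set G)) :
  (forall A, B_family A -> directed_in A) ->
  exists p : set G -> X -> X, [/\
    forall A, B_family A -> p A 0 = 0,
    forall A x y, B_family A -> `|p A x - p A y| <= C * `|x - y|,
    forall A A' x, B_family A -> B_family A' -> A `<=` A' ->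
      p A (p A' x) = p A x /\ p A' (p A x) = p A x,
    forall A x, B_family A -> near_fix A (p A x) &
    forall A x, B_family A -> near_fix A x -> p A x = x].
Proof.
move=> dir.
have /choice[p pP] (A : set G) : exists p : X -> X, B_family A -> forall x,
    near_fix A (p x) /\ forall a, A a -> P a (p x) = P a x.
  have [/dir dA|nA] := pselect (B_family A); last by exists id.
  have /choice[p pP] x := directed_limit x dA.
  by exists p.
have uniq A x y : B_family A -> near_fix A y ->
    (forall a, A a -> P a y = P a x) -> p A x = y.
  move=> BA Ay yx; have [Ap px] := pP _ BA x.
  apply/subr0_eq/eqP; rewrite -normr_le0.
  apply: (near_fix_bound (dir _ BA) (near_fixD (dir _ BA) Ap Ay)) => // a Aa.
  by rewrite linearB px// yx// subrr normr0.
have pid A x : B_family A -> near_fix A x -> p A x = x by move=> BA Ax; apply: uniq.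
exists p; split=> //.
- by move=> A BA; apply: pid => // e e0; exists 0; [left|rewrite subrr normr0].
- move=> A x y BA; have [Ax px] := pP _ BA x; have [Ay py] := pP _ BA y.
  apply: (near_fix_bound (dir _ BA) (near_fixD (dir _ BA) Ax Ay)) => [|a Aa].
    by rewrite mulr_ge0.
  by rewrite linearB px// py// -linearB; exact: (dir _ BA).1.
- move=> A A' x BA BA' AA'; have [Ax px] := pP _ BA x.
  split; last by apply: pid => //; exact: near_fixS Ax.
  apply: uniq => // a Aa; rewrite px//.
  by have [_ ->] := pP _ BA' x; last exact: AA'.
- by move=> A x BA; have [] := pP _ BA x.
Qed.


End directed_limits.
End skeleton.

(** * Lipschitz-free spaces *)

Section lipfree_facts.
Context {R : realType} (M : metricType R) (o : M).
Local Notation Y := (lipfree o).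
Implicit Types (mu nu : Y) (f g : lip0 o).

Lemma lipfree_ext mu nu : (forall f, mu f = nu f) -> mu = nu.
Proof. by move=> h; apply/val_inj/val_inj/funext. Qed.

Lemma lipfree_le mu f : `|mu f| <= `|mu| * `|f|.
Proof. exact: dual_normP. Qed.

Lemma lipfree_norm_le mu k : 0 <= k -> (forall f, `|mu f| <= k * `|f|) ->
  `|mu| <= k.
Proof. exact: least_const_le. Qed.

Lemma lip0_norm_le f k : 0 <= k ->
  (forall x y, `|f x - f y| <= k * mdist x y) -> `|f| <= k.
Proof. by move=> k0 h; apply: least_const_le => // -[x y]; exact: h. Qed.

Lemma lipfreeD mu nu f : (mu + nu) f = mu f + nu f.
Proof. by []. Qed.

Lemma lipfreeB mu nu f : (mu - nu) f = mu f - nu f.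
Proof. by []. Qed.

Lemma lipfreeZ (a : R) mu f : (a *: mu) f = a * mu f.
Proof. by []. Qed.

Lemma lipfree_linB mu f g : mu (f - g) = mu f - mu g.
Proof.
by rewrite addrC -scaleN1r dual_linear mulN1r addrC.
Qed.

Lemma lipfree_linZ mu (a : R) f : mu (a *: f) = a * mu f.
Proof.
have mu0 : mu 0 = 0 by rewrite -[0 in LHS](subrr 0) lipfree_linB subrr.
by rewrite -[a *: f]addr0 dual_linear mu0 addr0.
Qed.

Fact ldelta_subproof (x : M) : delta o x \in @lipfree_pred R M o.
Proof. by apply/asboolP/sub_clspan; exists x. Qed.

Definition ldelta (x : M) : Y := LipFree (ldelta_subproof x).

Lemma ldeltaE x f : ldelta x f = f x.
Proof. by []. Qed.

Lemma ldelta_base : ldelta o = 0.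
Proof. by apply: lipfree_ext => f; rewrite ldeltaE lip0_base. Qed.

Lemma ldelta_lip x y : `|ldelta x - ldelta y| <= mdist x y.
Proof.
apply: lipfree_norm_le => [|f]; first exact: mdist_ge0.
by rewrite lipfreeB !ldeltaE mulrC; exact: lip0_normP.
Qed.

Lemma lipfree_span mu : clspan (range ldelta) mu.
Proof.
have /asboolP/closure_normP h := valP mu; apply/closure_normP => e e0.
have sub : lin_span (range (delta o)) `<=`
    [set phi | exists2 y : Y, lin_span (range ldelta) y & lipfree_val y = phi].
  have linS := lin_set_span (range ldelta).
  apply: lin_span_min => [|_ [x _ <-]]; last first.
    by exists (ldelta x) => //; apply: sub_lin_span; exists x.
  split=> [|a _ _ [y Sy <-] [z Sz <-]]; first by exists 0 => //; exact: linS.1.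
  by exists (a *: y + z) => //; exact: linS.2.
have [_ /sub[y Sy <-] mue] := h e e0.
by exists y.
Qed.

Lemma norming_lipfree : @norming R Y.
Proof.
move=> mu; have [->|mu0] := eqVneq mu 0.
  exists (fun=> 0); split; last by rewrite !normr0 mulr0.
  split=> [a u v _ _|u _]; first by rewrite scaler0 addr0.
  by rewrite normr0 mul1r.
have mu1 : 0 < `|mu| by rewrite normr_gt0.
have [f fmu] : exists f, `|mu| / 2 * `|f| < `|mu f|.
  apply: contrapT => /forallNP h.
  have : `|mu| <= `|mu| / 2.
    apply: lipfree_norm_le => [|f]; first by rewrite divr_ge0.
    by rewrite leNgt; apply/negP.
  by rewrite leNgt gtr_pMr// invf_lt1// ltr1n.
have f0 : 0 < `|f|.
  rewrite normr_gt0; apply/negP => /eqP f0; move: fmu.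
  by rewrite f0 normr0 mulr0 -[0 : lip0 o](scale0r 0) lipfree_linZ mul0r normr0 ltxx.
exists (fun nu => nu (`|f|^-1 *: f)); split.
  split=> // nu _; rewrite (le_trans (lipfree_le _ _))// mul1r.
  by rewrite normrZ normfV normr_id mulVf ?gt_eqF// mulr1.
rewrite lipfree_linZ normrM normfV normr_id mulrCA ler_pdivlMl//.
by rewrite -ler_pdivrMl// mulrC -mulrA mulrC ltW.
Qed.

Fact comp_subproof (p : M -> M) (C : R) (pl : p o = o /\
  forall x y, mdist (p x) (p y) <= C * mdist x y) f :
  (f \o p) \in @lip0_pred R M o.
Proof.
case: pl => po pC; apply/asboolP; split; first by rewrite /= po lip0_base.
exists (`|f| * C) => x y /=; rewrite (le_trans (lip0_normP _ _ _))//.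
by rewrite -mulrA ler_wpM2l.
Qed.

(** [h] is the adjoint of the composition operator f |-> f o p. It sends evaluations to evaluations,
    hence by density F(M) into itself. *)
Lemma lipfree_push (p : M -> M) (C : R) : 0 <= C -> p o = o ->
  (forall x y, mdist (p x) (p y) <= C * mdist x y) ->
  exists h : Y -> Y, [/\ op_on [set: Y] C h,
    forall x, h (ldelta x) = ldelta (p x) &
    forall mu f g, (forall x, g x = f (p x)) -> h mu f = mu g].
Proof.
move=> C0 po pC.
pose cp f : lip0 o := Lip0 (comp_subproof (conj po pC) f).
have cpn f : `|cp f| <= C * `|f|.
  apply: lip0_norm_le => [|x y]; first exact: mulr_ge0.
  by rewrite mulrAC mulrC (le_trans (lip0_normP f _ _))// ler_wpM2l.
have hd mu : (fun f => mu (cp f)) \in @dual_pred R (lip0 o).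
  apply/asboolP; split=> [a f g|].
    by rewrite -dual_linear; congr (_ _); apply/val_inj/funext.
  exists (`|mu| * C) => f; rewrite (le_trans (lipfree_le _ _))// -mulrA.
  by rewrite ler_wpM2l.
have hn mu k : 0 <= k -> `|mu| <= k -> `|Dual (hd mu)| <= C * k.
  move=> k0 muk; apply: least_const_le => [|f]; first exact: mulr_ge0.
  rewrite (le_trans (lipfree_le _ _))// [C * k]mulrC -mulrA.
  by rewrite ler_pM.
have hin mu : Dual (hd mu) \in @lipfree_pred R M o.
  apply/asboolP/closure_normP => e e0.
  have C1 : 0 < C + 1 by rewrite ltr_wpDl.
  have [nu Snu mue] := clspan_approx (@lipfree_span mu) (divr_gt0 e0 C1).
  have sub : lin_span (range ldelta) `<=`
      [set nu | lin_span (range (delta o)) (Dual (hd nu))].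
    have linS := lin_set_span (range (delta o)).
    apply: lin_span_min => [|_ [x _ <-]].
      split=> [|a y z Sy Sz].
        rewrite /= (_ : Dual _ = 0); first exact: linS.1.
        by apply/val_inj/funext.
      rewrite /= (_ : Dual _ = a *: Dual (hd y) + Dual (hd z)); first exact: linS.2.
      by apply/val_inj/funext.
    apply: sub_lin_span; exists (p x) => //; by apply/val_inj/funext.
  exists (Dual (hd nu)); first exact: sub.
  have -> : Dual (hd mu) - Dual (hd nu) = Dual (hd (mu - nu)).
    by apply/val_inj/funext.
  rewrite (le_lt_trans (hn _ _ _ (ltW mue)))//.
    by rewrite ltW// divr_gt0.
  by rewrite mulrCA gtr_pMr// ltr_pdivrMr// mul1r ltrDl.
exists (fun mu => LipFree (hin mu)); split.
- split=> [a mu nu _ _|mu _]; first by apply: lipfree_ext.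
  exact: hn.
- by move=> x; apply: lipfree_ext.
- by move=> mu f g gf; congr (mu _); apply/val_inj/funext => x /=; rewrite gf.
Qed.

End lipfree_facts.

(** * Markushevich bases from skeletons *)

(** The order axioms are read off from minima of sets with one, two or three elements. *)
Lemma well_order_strict (T : eqType) : exists lt : T -> T -> Prop,
  [/\ well_founded lt, forall x y z, lt x y -> lt y z -> lt x z &
      forall x y, x = y \/ lt x y \/ lt y x].
Proof.
have [r wr] := wochoice.well_ordering_principle T.
have min (A : {pred T}) x : x \in A -> exists2 z, z \in A & forall y, y \in A -> r z y.
  by move=> Ax; have [|z [[Az zmin] _]] := wr A; [exists x|exists z].
have anti x y : r x y -> r y x -> x = y.
  move=> xy yx; have rr z : r z z.
    by have [_ /eqP -> zz] := min (pred1 z) z (eqxx z); exact/zz/eqxx.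
  have [|z [_ zu]] := wr (pred2 x y); first by exists x; rewrite inE eqxx.
  rewrite -(zu x); first apply: zu.
    by split; [rewrite inE eqxx orbT|move=> w; rewrite inE => /orP[]/eqP ->].
  by split; [rewrite inE eqxx|move=> w; rewrite inE => /orP[]/eqP ->].
have tot x y : r x y \/ r y x.
  have [z] := min (pred2 x y) x (predU1l _ erefl).
  rewrite !inE => /orP[]/eqP -> h; [left|right]; apply: h;
    by rewrite inE eqxx ?orbT.
have tr x y z : r x y -> r y z -> r x z.
  move=> xy yz; have [m] := min (pred3 x y z) x (predU1l _ erefl).
  rewrite inE => /or3P[]/eqP -> h.
  - by apply: h; rewrite inE eqxx !orbT.
  - by have <- : y = x by apply: anti => //; apply: h; rewrite inE eqxx.
  - have <- : y = z by apply: anti => //; apply: h; rewrite inE eqxx orbT.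
    by [].
exists (fun x y => r x y /\ x <> y); split.
- move=> x; apply: contrapT => nx.
  pose bad := [pred y | `[< ~ Acc (fun x y => r x y /\ x <> y) y >]].
  have [|z /asboolP nz zmin] := min bad x; first exact/asboolP.
  apply: nz; constructor=> y [yz nyz]; apply: contrapT => ny.
  by apply: nyz; apply: anti => //; apply: zmin; exact/asboolP.
- move=> x y z [xy nxy] [yz nyz]; split; first exact: tr yz.
  by move=> xz; apply: nxy; apply: anti => //; rewrite xz.
- move=> x y; have [->|nxy] := pselect (x = y); first by left.
  right; have [h|h] := tot x y; [by left|right; split=> //].
  by move=> yx; apply: nxy.
Qed.

Lemma mbasis_markushevich (R : realType) (Y : normedModType R) b :
  @mbasis_on R Y setT b -> has_markushevich_basis Y.
Proof.
move=> [bZ b1 b0 bspan bsep].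
have xd (i : {p | b p}) : (sval i).2 \in @dual_pred R Y.
  have [_ [k [kl kb]]] := bZ _ (svalP i).
  by apply/asboolP; split=> [a u v|]; [exact: kl|exists k => u; exact: kb].
exists {p | b p}, (fun i => (sval i).1), (fun i => Dual (xd i)); split.
- by move=> i; exact: b1 (svalP i).
- move=> i j ij /=; apply: b0; [exact: svalP|exact: svalP|].
  case: i j ij => [p bp] [p' bp'] + /= pp'; apply; subst p'.
  by congr exist; exact: Prop_irrelevance.
- apply/seteqP; split=> // y _.
  apply: clspanS (bspan y I) => _ [p bp <-].
  by exists (exist _ p bp).
- move=> u v uv; apply/subr0_eq/bsep => // p bp.
  have [_ [k kop]] := bZ _ bp.
  have /= := uv (exist _ p bp).
  by rewrite (op_onB kop)// => ->; rewrite subrr.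
Qed.

(** Indices are restricted to the cofinal set [B] of uniformly bounded projections, and [F] chooses
    upper bounds in [B], so stable sets are directed. The generators [q s n] are the evaluations at
    a dense sequence of the range of [P s]. *)
Lemma lipfree_skeleton_mbasis (R : realType) (X : completeNormedModType R) :
  has_projectional_skeleton X ->
  has_markushevich_basis (@lipfree R (metric_of_normed X) 0).
Proof.
move=> [d [G [P skP]]].
have [C [C0 cof]] := skeleton_uniform skP.
pose B : set G := [set s | bdd_by P C s].
have /choice[c cP] (ab : G * G) : exists c, [/\ B c, (ab.1 <= c)%O & (ab.2 <= c)%O].
  have [u [u1 u2]] := skeleton_directed skP ab.1 ab.2.
  have [t ut Bt] := cof u; exists t; split=> //.
    exact: Order.POrderTheory.le_trans ut.
  exact: Order.POrderTheory.le_trans ut.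
pose F a b := [set c (a, b)].
pose fam : set (set G) := [set A | stable F A /\ A `<=` B].
have famB : fam B by split=> // a b _ _ _ ->; have [] := cP (a, b).
have dir A : fam A -> directed_in P C A.
  move=> [As AB]; split=> // a b Aa Ab; have [_ ac bc] := cP (a, b).
  by exists (c (a, b)); split=> //; exact: (As a b).
have [p [p0 pl ple pnear pid]] := directed_projections skP C0 dir.
have nearB x : near_fix P B x.
  move=> e e0; exists x; last by rewrite subrr normr0.
  have : [set: X] x by []; rewrite -(skeleton_cover skP) => -[s _ [y _ yx]].
  have [t st Bt] := cof s; right; exists t => //.
  by apply: (skeleton_fixS skP st); rewrite -yx (skeleton_proj skP).
have /choice[dd ddP] s : exists w : nat -> X, (forall n, P s (w n) = w n) /\
    forall x e, P s x = x -> 0 < e -> exists n, `|x - w n| < e.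
  have [A [cA AP PA]] := skeleton_separable skP s.
  have [w [j [wA Aw]]] := countable_enum (0 : X) cA.
  exists w; split=> [n|x e sx e0].
    have [->|/AP[y _ <-]] := wA n; first by rewrite linear0.
    exact: skeleton_proj skP _ _.
  have : range (P s) x by exists x.
  move=> /PA/closure_normP/(_ e e0)[y /Aw yE xy].
  by exists (j y); rewrite yE.
pose M := metric_of_normed X; pose o : M := (0 : X).
pose Y := lipfree o.
have /choice[h hP] (A : set G) : exists h : Y -> Y, fam A ->
    [/\ op_on [set: Y] C h, forall x, h (ldelta o x) = ldelta o (p A x) &
    forall mu (f g : lip0 o), (forall x, g x = f (p A x)) -> h mu f = mu g].
  have [fA|nA] := pselect (fam A); last by exists id.
  have [|x y|h hP] := @lipfree_push R M o (p A) C C0; [exact: p0|exact: pl|].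
  by exists h.
have hcomp A A' A'' mu : fam A -> fam A' -> fam A'' ->
    (forall x, p A (p A' x) = p A'' x) -> h A (h A' mu) = h A'' mu.
  move=> fA fA' fA'' pp; have [_ _ hf] := hP A fA.
  have [_ _ hf'] := hP A' fA'; have [_ _ hf''] := hP A'' fA''.
  apply: lipfree_ext => f.
  have pA0 : p A o = o by exact: p0.
  have pA'0 : p A' o = o by exact: p0.
  have pAl (x y : M) : mdist (p A x : M) (p A y) <= C * mdist x y by exact: pl.
  have pA'l (x y : M) : mdist (p A' x : M) (p A' y) <= C * mdist x y by exact: pl.
  pose g1 : lip0 o := Lip0 (@comp_subproof R M o (p A) C (conj pA0 pAl) f).
  pose g2 : lip0 o := Lip0 (@comp_subproof R M o (p A') C (conj pA'0 pA'l) g1).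
  rewrite (hf _ f g1)// (hf' _ g1 g2)//; symmetry; apply: hf'' => x /=.
  by rewrite pp.
pose q s n : Y := ldelta o (dd s n).
have sk : skeletal [set: Y] B F h q C.
  split=> //.
  - by move=> a b; exact: countable1.
  - by case: famB.
  - by move=> A As AB; have [] := hP A (conj As AB).
  - move=> A A' mu As A's AA' A'B _.
    have fA' : fam A' by [].
    have fA : fam A by split=> //; exact: subset_trans A'B.
    by split; apply: hcomp => // x; have [] := ple A A' x fA fA' AA'.
  - move=> mu _; have [_ _ hf] := hP B famB.
    apply: lipfree_ext => f; apply: hf => x.
    by rewrite (pid B).
  - move=> A s n As AB Asm; have fA : fam A by [].
    have [_ hd _] := hP A fA; rewrite /q hd (pid A)// => e e0.
    exists (dd s n); last by rewrite subrr normr0.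
    by right; exists s => //; have [] := ddP s.
  - move=> A mu As AB _ <-; have fA : fam A by [].
    have [hop hd _] := hP A fA.
    have sub : clspan (range (ldelta o)) `<=`
        [set mu | clspan (span_of q A) (h A mu)].
      have linS := lin_set_clspan (span_of q A).
      apply: clspan_min => [|nu nucl|_ [x _ <-]] /=.
      - split=> [|a u v Su Sv].
          by rewrite /= (op_on0 lin_setT hop); exact: linS.1.
        by rewrite /= hop.1//; exact: linS.2.
      - apply/closure_closureS/closure_normP => e e0.
        have C1 : 0 < C + 1 by rewrite ltr_wpDl.
        have /closure_normP/(_ _ (divr_gt0 e0 C1))[y Sy nuy] := nucl.
        exists (h A y) => //; rewrite -(op_onB hop)// (le_lt_trans (hop.2 _ I))//.
        rewrite (@le_lt_trans _ _ (C * (e / (C + 1))))//.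
          by rewrite ler_wpM2l// ltW.
        by rewrite mulrCA gtr_pMr// ltr_pdivrMr// mul1r ltrDl.
      - rewrite hd; apply/closure_closureS/closure_normP => e e0.
        have e2 : 0 < e / 2 by rewrite divr_gt0.
        have [z zA xz] := pnear A x fA _ e2.
        have xzl : `|ldelta o (p A x) - ldelta o z| < e / 2.
          exact: le_lt_trans (ldelta_lip o _ _) xz.
        case: zA xzl => [->|[a Aa az] _].
          rewrite [ldelta o 0]ldelta_base => xzl; exists 0; first exact: linS.1.
          by rewrite (lt_trans xzl)// ltr_pdivrMr// ltr_pMr// ltr1n.
        have [n zn] := (ddP a).2 z _ az e2.
        exists (q a n); first by apply: sub_clspan; exists a, n.
        apply: le_lt_trans (ldelta_lip o _ _) _.
        have -> : mdist (p A x : M) (dd a n) = `|p A x - dd a n| by [].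
        by rewrite (le_lt_trans (ler_distD z _ _))// [ltRHS]splitr ltrD.
    exact/sub/lipfree_span.
have [lt [wf tr tot]] := well_order_strict G.
have [b0 Bb0] : exists b0, B b0.
  have : [set: X] 0 by []; rewrite -(skeleton_cover skP) => -[s _ _].
  by have [t _ Bt] := cof s; exists t.
(* The well-order lives on all of [G]; indices outside [B] are sent to a default one. *)
pose s x := if `[< B x >] then x else b0.
have gB : gen F (range s) = B.
  apply/seteqP; split.
    apply: gen_min; first by case: famB.
    by move=> _ [x _ <-]; rewrite /s; case: asboolP.
  move=> x Bx; apply: sub_gen; exists x => //.
  by rewrite /s; case: asboolP.
rewrite -gB in sk.
have [b bP] := mbasis_skeletal wf tr tot (@norming_lipfree R M o) sk.
exact: mbasis_markushevich bP.
Qed.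

(** * Weak* separability *)

Section wstar.
Context {R : realType} (M : metricType R) (o : M).
Local Notation Y := (lipfree o).
Implicit Types (mu nu : Y) (f g h : lip0 o).

(** The identification F(M)^* = Lip_0(M): phi is represented by x |-> phi(delta(x)), as two bounded
    functionals agreeing on evaluations agree on their closed span. *)
Lemma lipfree_repr (phi : Y -> R^o) k : op_on [set: Y] k phi ->
  exists f, `|f| <= `|k| /\ forall mu, mu f = phi mu.
Proof.
move=> phiop.
have lip x y : `|phi (ldelta o x) - phi (ldelta o y)| <= `|k| * mdist x y.
  rewrite -(op_onB phiop)// (le_trans (phiop.2 _ I))//.
  rewrite (@le_trans _ _ (`|k| * `|ldelta o x - ldelta o y|))//.
    by rewrite ler_wpM2r// ler_norm.
  by rewrite ler_wpM2l// ldelta_lip.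
have fin : (phi \o ldelta o) \in @lip0_pred R M o.
  apply/asboolP; split; first by rewrite /= ldelta_base (op_on0 lin_setT phiop).
  by exists `|k|.
exists (Lip0 fin); split; first exact: lip0_norm_le.
move=> mu.
have dop : op_on [set: Y] (`|Lip0 fin| + k) (fun mu => mu (Lip0 fin) - phi mu : R^o).
  split=> [a u v _ _|u _].
    by rewrite lipfreeD lipfreeZ phiop.1// scalerBr opprD addrACA.
  rewrite (le_trans (ler_normB _ _))// mulrDl lerD//; last exact: phiop.2.
  by rewrite mulrC; exact: lipfree_le.
suff : [set mu | [set: Y] mu /\ mu (Lip0 fin) - phi mu = 0] mu.
  by move=> [_ /subr0_eq].
have := @lipfree_span _ _ o mu; apply: clspan_min.
- exact: (op_on_ker_lin lin_setT dop).
- by apply: (op_on_ker_closed lin_setT _ dop) => x _.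
- by move=> _ [x _ <-]; split=> //; rewrite ldeltaE subrr.
Qed.

(** A functional vanishing on the common kernel of finitely many others is a combination of them, by
    induction with [W] cut down to the kernel of [m]. Being such a combination is recorded as
    dependence on the values of the members of [s] alone. *)
Lemma functional_on_kernel (W : set (lip0 o)) (s : seq Y) (phi : Y) : lin_set W ->
  (forall h, W h -> (forall m, m \in s -> m h = 0) -> phi h = 0) ->
  exists nu, (forall f g, (forall m, m \in s -> m f = m g) -> nu f = nu g) /\
    forall h, W h -> phi h = nu h.
Proof.
elim: s W => [|m s IH] W linW phiW.
  by exists 0; split=> // h Wh; rewrite phiW.
have linW' : lin_set [set h | W h /\ m h = 0].
  split=> [|a u v [Wu mu] [Wv mv]].
    split; first exact: linW.1.
    by rewrite -[0 : lip0 o](scale0r 0) lipfree_linZ mul0r.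
  by split; [exact: linW.2|rewrite dual_linear mu mv mulr0 addr0].
have [|nu [nus nuW]] := IH _ linW'.
  move=> h [Wh mh] hs; apply: phiW => // m'.
  by rewrite inE => /predU1P[->|]; [|exact: hs].
have [m0|] := pselect (forall h, W h -> m h = 0).
  exists nu; split=> [f g fg|h Wh]; last by apply: nuW; split=> //; exact: m0.
  by apply: nus => m' m's; apply: fg; rewrite inE m's orbT.
move=> /existsNP[h0 /not_implyP[Wh0 /eqP mh0]].
exists (nu + ((phi h0 - nu h0) / m h0) *: m); split=> [f g fg|h Wh].
  rewrite !lipfreeD !lipfreeZ (fg m) ?inE ?eqxx//; congr (_ + _).
  by apply: nus => m' m's; apply: fg; rewrite inE m's orbT.
pose c := m h / m h0.
have cker : W (h - c *: h0) /\ m (h - c *: h0) = 0.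
  split; first by apply: lin_setB => //; exact: lin_setZ.
  by rewrite lipfree_linB lipfree_linZ divfK// subrr.
have := nuW _ cker; rewrite !lipfree_linB !lipfree_linZ lipfreeD lipfreeZ => /eqP.
rewrite subr_eq => /eqP ->; rewrite -addrA; congr (_ + _).
by rewrite addrC -mulrBr /c mulrAC [RHS]mulrAC [_ * m h]mulrC.
Qed.

(** To add [m], correct [g] by some h in [W] killed by [s] but not by [m]. If there is none, [m]
    depends on [s] over [W], hence everywhere by separation, and its value already matches. *)
Lemma lipfree_interpolation (W : set (lip0 o)) (s : seq Y) f : lin_set W ->
  (forall mu, (forall g, W g -> mu g = 0) -> mu = 0) ->
  exists2 g, W g & forall m, m \in s -> m g = m f.
Proof.
move=> linW sepW; elim: s => [|m s [g Wg gf]]; first by exists 0 => //; exact: linW.1.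
have [[h [Wh hs /eqP mh]]|nh] :=
    pselect (exists h, [/\ W h, forall m, m \in s -> m h = 0 & m h <> 0]).
  exists (((m f - m g) / m h) *: h + g); first exact: linW.2.
  move=> m'; rewrite inE => /predU1P[->|m's].
    by rewrite dual_linear divfK// subrK.
  by rewrite dual_linear (hs m')// mulr0 add0r gf.
have [|nu [nus nuW]] := @functional_on_kernel W s m linW.
  by move=> h Wh hs; apply: contrapT => mh; apply: nh; exists h.
have mnu : m = nu.
  apply/subr0_eq/sepW => h Wh; by rewrite lipfreeB nuW// subrr.
exists g => // m'; rewrite inE => /predU1P[->|]; last exact: gf.
by rewrite mnu; exact: nus.
Qed.

Lemma wstar_closure (A : set (lip0 o)) f :
  (forall (s : seq Y) e, 0 < e ->
    exists2 g, A g & forall m, m \in s -> `|m f - m g| < e) ->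
  closure (A : set (lip0_wstar o)) f.
Proof.
move=> Af B.
pose near_on (p : seq Y * R) : set (lip0 o) :=
  [set g | forall m, m \in p.1 -> `|m f - m g| < p.2].
(* The filter of finite-dimensional neighbourhoods of [f], which converges to [f] pointwise on
   F(M). *)
pose F := filter_from [set p : seq Y * R | 0 < p.2] near_on.
have FF : Filter F.
  apply: filter_from_filter; first by exists ([::], 1) => /=.
  move=> [s e] [t d] /= e0 d0; exists (s ++ t, Num.min e d).
    by rewrite /= lt_min e0.
  move=> g gst; split=> m /= ms.
    have := gst m; rewrite /= mem_cat ms => /(_ isT); rewrite lt_min.
    by case/andP.
  have := gst m; rewrite /= mem_cat ms orbT => /(_ isT); rewrite lt_min.
  by case/andP.
have cvgF : {ptws, (@lip0_pairing R M o) @ F --> (lip0_pairing f : {ptws Y -> R})}.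
  apply/pointwise_cvgP => mu; apply/cvgrPdist_lt => e e0.
  by exists ([:: mu], e) => // g /(_ mu); rewrite inE eqxx => /(_ isT).
rewrite nbhsE => -[_ [[U oU <-] Uf] UB].
have /cvgF [[s e] /= e0 sU] : nbhs (lip0_pairing f : {ptws Y -> R}) U.
  exact: open_nbhs_nbhs.
have [g Ag gs] := Af s e e0.
by exists g; split=> //; apply: UB; exact: sU.
Qed.

Lemma wstar_separable_of_separating (D : set (lip0 o)) : countable D ->
  (forall mu, (forall g, D g -> mu g = 0) -> mu = 0) ->
  separable_set [set: lip0_wstar o].
Proof.
move=> cD sepD.
have [w [j [_ jP]]] := countable_enum (0 : lip0 o) cD.
pose A : set (lip0 o) := range (fun n => ratcomb [seq (p.1, w p.2) | p <-
  odflt [::] (unpickle n : option (seq (rat * nat)))]).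
exists A; split=> //.
  have cN : countable [set: nat] by [].
  by apply: sub_countable cN; exact: card_image_le.
move=> f _; apply: wstar_closure => s e e0.
have [g Wg gf] : exists2 g, lin_span D g & forall m, m \in s -> m g = m f.
  apply: lipfree_interpolation; first exact: lin_set_span.
  by move=> mu muD; apply: sepD => g Dg; apply: muD; exact: sub_lin_span.
pose K := 1 + \sum_(m <- s) `|m|.
have K0 : 0 < K by rewrite ltr_pwDl// sumr_ge0.
have [t [tD gt]] := ratcomb_approx Wg (divr_gt0 e0 K0).
exists (ratcomb t).
  exists (pickle [seq (p.1, j p.2) | p <- t]) => //.
  rewrite pickleK /= -map_comp; congr ratcomb; rewrite -[RHS]map_id.
  by apply/eq_in_map => -[r h] /tD /= Dh; rewrite jP.
move=> m ms; rewrite -gf// -lipfree_linB (le_lt_trans (lipfree_le _ _))//.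
rewrite (@le_lt_trans _ _ (K * `|g - ratcomb t|))//.
  rewrite ler_wpM2r// /K (big_rem m)//= addrCA lerDl addr_ge0//.
  by rewrite sumr_ge0.
by rewrite mulrC -ltr_pdivlMr.
Qed.

(** The mu for which convergence holds form a linear set, closed thanks to the bound on the norms,
    and this set contains the evaluations. *)
Lemma wstar_limit (f_ : nat -> lip0 o) f k mu : (forall n, `|f_ n| <= k) ->
  (forall x, f_ n x @[n --> \oo] --> f x) -> mu (f_ n) @[n --> \oo] --> mu f.
Proof.
move=> fk fx.
have k0 : 0 <= k by exact: le_trans (fk 0%N).
have := @lipfree_span _ _ o mu; move: mu.
apply: clspan_min => [|mu mucl|_ [x _ <-]].
- split=> [|a u v /= cu cv]; first exact: cvg_cst.
  by apply: cvgD => //; apply: cvgMr.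
- apply/cvgrPdist_le => e e0.
  have K0 : 0 < `|f| + k + 1 by rewrite ltr_wpDl// addr_ge0.
  have e2 : 0 < e / 2 by rewrite divr_gt0.
  have /closure_normP/(_ _ (divr_gt0 e2 K0))[nu nuf munu] := mucl.
  have /cvgrPdist_le/(_ _ e2) := nuf.
  apply: filterS => n nun.
  have -> : mu f - mu (f_ n) = (mu - nu) (f - f_ n) + (nu f - nu (f_ n)).
    by rewrite lipfreeB !lipfree_linB [RHS]subrK.
  rewrite (le_trans (ler_normD _ _))// [leRHS]splitr lerD//.
  rewrite (le_trans (lipfree_le _ _))//.
  rewrite (@le_trans _ _ (e / 2 / (`|f| + k + 1) * (`|f| + k + 1)))//.
    rewrite ler_pM// ?(ltW munu)// (le_trans (ler_normB _ _))//.
    by rewrite (le_trans (lerD (lexx _) (fk n)))// lerDl.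
  by rewrite divfK// gt_eqF.
- exact: fx.
Qed.

Section positive_sup.
Variables (I : Type) (u : I -> lip0 o) (k : R).
Hypothesis k0 : 0 <= k.
Hypothesis uk : forall i, `|u i| <= k.

Definition psup (U : set I) (x : M) : R :=
  sup [set r | exists2 i, U i & r = Num.max 0 (u i x)].

Let lipu i x y : u i x <= u i y + k * mdist x y.
Proof.
rewrite -lerBlDl (le_trans (ler_norm _))// (le_trans (lip0_normP _ _ _))//.
by apply: ler_wpM2r; [exact: mdist_ge0|exact: uk].
Qed.

Lemma psup_ub U i x : U i -> Num.max 0 (u i x) <= psup U x.
Proof.
move=> Ui; apply: ub_le_sup; last by exists i.
exists (k * mdist x o) => _ [j _ ->]; rewrite ge_max mulr_ge0 ?mdist_ge0//=.
by have := lipu j x o; rewrite lip0_base add0r.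
Qed.

Lemma psup_le U x b : U !=set0 -> (forall i, U i -> Num.max 0 (u i x) <= b) ->
  psup U x <= b.
Proof.
move=> [i Ui] h; apply: ge_sup; first by exists (Num.max 0 (u i x)); exists i.
by move=> _ [j Uj ->]; exact: h.
Qed.

Lemma psup_lip U x y : U !=set0 -> `|psup U x - psup U y| <= k * mdist x y.
Proof.
move=> U0.
have main x' y' : psup U x' <= psup U y' + k * mdist x' y'.
  apply: psup_le => // i Ui; rewrite ge_max; apply/andP; split.
    rewrite addr_ge0// ?mulr_ge0 ?mdist_ge0// (le_trans _ (psup_ub _ Ui))//.
    by rewrite le_max lexx.
  rewrite (le_trans (lipu _ _ y'))// lerD2r (le_trans _ (psup_ub _ Ui))//.
  by rewrite le_max lexx orbT.
by rewrite ler_distl main andbT lerBlDr [mdist x y]metric_sym main.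
Qed.

Fact psup_subproof (U : {U : set I | U !=set0}) : psup (sval U) \in @lip0_pred R M o.
Proof.
apply/asboolP; split; last by exists k => x y; apply: psup_lip; exact: svalP U.
apply/eqP; rewrite eq_le psup_le//=; last 2 first.
- exact: svalP U.
- by move=> i _; rewrite lip0_base maxxx.
have [i Ui] := svalP U; apply: le_trans (psup_ub _ Ui).
by rewrite le_max lexx.
Qed.

Definition psup_lip0 U : lip0 o := Lip0 (psup_subproof U).

Lemma psup_lip0_norm U : `|psup_lip0 U| <= k.
Proof. by apply: lip0_norm_le => // x y; apply: psup_lip; exact: svalP U. Qed.

End positive_sup.

End wstar.

Definition cylinder (s : seq bool) : set (nat -> bool) :=
  [set h | forall i, (i < size s)%N -> h i = nth false s i].

Lemma cylinder_neq0 s : cylinder s !=set0.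
Proof. by exists (nth false s). Qed.

(** * Suprema over shrinking cylinders *)

Section c0_family.
Context {R : realType} (M : metricType R) (o : M).
Local Notation Y := (lipfree o).

(** Only finitely many h have |u_h(x)| at least e, and each one other than g leaves the cylinder
    once its length passes a coordinate where h and g differ. *)
Lemma psup_cylinder_cvg (u : (nat -> bool) -> lip0 o) k x g : 0 <= k ->
  (forall i, `|u i| <= k) ->
  (forall e, 0 < e -> finite_set [set i | e <= `|u i x|]) ->
  psup u (cylinder (mkseq g n)) x @[n --> \oo] --> Num.max 0 (u g x).
Proof.
move=> k0 uk ufin; apply/cvgrPdist_le => e e0.
have /finite_seqP[s sE] := ufin e e0.
have /choice[i iP] (h : nat -> bool) : exists i, h <> g -> h i <> g i.
  have [hg|hg] := pselect (h = g); first by exists 0%N.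
  by apply: contrapT => /forallNP hi; apply: hg; apply/funext => i;
    have /not_implyP[_ /contrapT] := hi i.
exists (\max_(h <- s) (i h)).+1 => // n /= ns.
have gn : cylinder (mkseq g n) g.
  by move=> j; rewrite size_mkseq => jn; rewrite nth_mkseq.
have h1 : psup u (cylinder (mkseq g n)) x <= Num.max 0 (u g x) + e.
  apply: (psup_le (cylinder_neq0 _)) => h hn.
  have [->|hg] := pselect (h = g); first by rewrite lerDl ltW.
  have hs : ~ h \in s.
    move=> hs; apply: (iP _ hg); rewrite hn ?size_mkseq ?nth_mkseq//;
    by apply: leq_trans ns; rewrite ltnS; apply: leq_bigmax_seq.
  have : ~ e <= `|u h x|.
    by move=> eu; apply: hs; have : [set` s] h by rewrite -sE.
  move=> /negP; rewrite -ltNge => uhe.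
  rewrite ge_max addr_ge0 ?(ltW e0) ?le_max ?lexx//=.
  rewrite (le_trans (ler_norm _))// (le_trans (ltW uhe))// lerDr.
  by rewrite le_max lexx.
have h2 := psup_ub k0 uk x gn.
by rewrite distrC ger0_norm ?subr_ge0// lerBlDl.
Qed.

(** The countable set consists of the cylinder suprema of u and of -u. If mu kills it, mu kills the
    positive parts of u_g and -u_g in the limit, and therefore their difference u_g. *)
Lemma wstar_separable_of_c0_family (u : (nat -> bool) -> lip0 o) k : 0 <= k ->
  (forall i, `|u i| <= k) ->
  (forall x e, 0 < e -> finite_set [set i | e <= `|u i x|]) ->
  (forall mu : Y, (forall i, mu (u i) = 0) -> mu = 0) ->
  separable_set [set: lip0_wstar o].
Proof.
move=> k0 uk ufin usep.
pose v (b : bool) i := if b then u i else - u i.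
have vk b i : `|v b i| <= k by case: b; rewrite /v ?normrN.
have vx b i x : `|v b i x| = `|u i x|.
  by case: b => //; rewrite -[RHS]normrN.
have vfin b x e : 0 < e -> finite_set [set i | e <= `|v b i x|].
  move=> e0; have := ufin x e e0; congr (finite_set _).
  by apply/seteqP; split=> i /=; rewrite vx.
pose D := range (fun p : bool * seq bool =>
  psup_lip0 k0 (vk p.1) (exist _ _ (cylinder_neq0 p.2))).
apply: (@wstar_separable_of_separating _ _ _ D).
  have cN : countable [set: bool * seq bool] by [].
  by apply: sub_countable cN; exact: card_image_le.
move=> mu muD; apply: usep => g.
have g0 : [set g] !=set0 by exists g.
(* A supremum over the singleton {g} is the positive part itself, already packed as an element of
   Lip_0(M). *)
pose pos b := psup_lip0 k0 (vk b) (exist _ _ g0).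
have posE b x : pos b x = Num.max 0 (v b g x).
  apply/eqP; rewrite eq_le (psup_ub k0 (vk b))//= andbT.
  by apply: psup_le => // i ->.
have mupos b : mu (pos b) = 0.
  pose f_ n := psup_lip0 k0 (vk b) (exist _ _ (cylinder_neq0 (mkseq g n))).
  have muf n : mu (f_ n) = 0 by apply: muD; exists (b, mkseq g n).
  have fpos x : f_ n x @[n --> \oo] --> pos b x.
    rewrite posE; apply: (psup_cylinder_cvg k0 (vk b)) => e; exact: vfin.
  have fk n : `|f_ n| <= k by exact: psup_lip0_norm.
  have := @wstar_limit _ _ _ f_ (pos b) k mu fk fpos.
  rewrite (_ : (fun n => _) = fun=> 0); last exact/funext.
  by move=> c0; apply/esym; apply: (cvg_unique _ (cvg_cst 0) c0).
have -> : u g = pos true - pos false.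
  apply/val_inj/funext => x.
  have -> : val (pos true - pos false) x = pos true x - pos false x by [].
  have vf : v false g x = - u g x by [].
  rewrite !posE vf; have -> : v true g x = u g x by [].
  have -> : val (u g) x = u g x by [].
  by have [h|h] := leP 0 (u g x); have [h'|h'] := leP 0 (- u g x); lra.
by rewrite lipfree_linB !mupos subrr.
Qed.

End c0_family.

(** * The families given by c_0 injections and by Markushevich bases *)

Lemma c0_normP (R : realType) (K : choiceType) (x : c0 R K) i : `|x i| <= `|x|.
Proof. by rewrite -[leRHS]mulr1; exact: (gaugeP _ (@c0_bounded R K)). Qed.

Lemma wstar_separable_of_c0_injection (R : realType) (M : metricType R) (o : M)
    (T : {linear lipfree o -> c0 R (nat -> bool)}) :
  bounded_op T -> injective T -> separable_set [set: lip0_wstar o].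
Proof.
move=> [k kT] Tinj.
have phiop i : op_on [set: lipfree o] `|k| (fun mu => T mu i : R^o).
  split=> [a u v _ _|u _]; first by rewrite linearP.
  rewrite (le_trans (c0_normP _ _))// (le_trans (kT u))// ler_wpM2r//.
  exact: ler_norm.
have /choice[u uP] i := lipfree_repr (phiop i).
apply: (@wstar_separable_of_c0_family _ _ _ u `|k|) => //.
- by move=> i; rewrite -[leRHS]normr_id; exact: (uP i).1.
- move=> x e e0; have /asboolP/(_ e e0) := valP (T (ldelta o x)).
  by congr finite_set; apply/seteqP; split=> i /=; rewrite -(uP i).2 ldeltaE.
- move=> mu muu; apply: Tinj; rewrite linear0; apply/val_inj/funext => i.
  by rewrite /= -(uP i).2 muu.
Qed.

(** The bits record, for every list of rationals, whether it is the list of coefficients, and all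
    bits of the coded entries. The coefficients also fix the length. *)
Lemma inj_seq_cantor (T : eqType) : (exists j : T -> nat -> bool, injective j) ->
  exists e : seq (rat * T) -> nat -> bool, injective e.
Proof.
move=> [j jinj].
pose e (t : seq (rat * T)) n := match (unpickle n : option (seq rat + nat * nat)) with
  | Some (inl q) => q == map fst t
  | Some (inr (i, m)) => nth (fun=> false) (map (j \o snd) t) i m
  | None => false end.
exists e => t t' tt'.
have ht n := congr1 (@^~ n) tt'.
have fE : map fst t = map fst t'.
  have := ht (pickle (inl (map fst t) : seq rat + nat * nat)).
  by rewrite /e !pickleK eqxx => /esym/eqP.
have sE : map (j \o snd) t = map (j \o snd) t'.
  apply: (@eq_from_nth _ (fun=> false)) => [|i _].
    by rewrite !size_map -(size_map fst) fE size_map.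
  apply/funext => m.
  by have := ht (pickle (inr (i, m) : seq rat + nat * nat)); rewrite /e !pickleK.
have {}sE : map snd t = map snd t'.
  by apply: (inj_map jinj); rewrite -!map_comp.
by rewrite -[t]zip_unzip -[t']zip_unzip /unzip1 /unzip2 fE sE.
Qed.

(** Rescaled so that the functionals have norm at most 1, the basis vectors [y i] are 1-separated.
    Rational combinations of evaluations on a dense set tell them apart, which embeds the index set
    in 2^N; the family is [f] along this embedding and zero elsewhere. *)
Lemma wstar_separable_of_mbasis (R : realType) (M : metricType R) (o : M) :
  dens_le M (nat -> bool) -> has_markushevich_basis (lipfree o) ->
  separable_set [set: lip0_wstar o].
Proof.
move=> [A [dA /pcard_injP[jM jMinj]]] [K [x [x' [xx xx0 xspan xsep]]]].
pose Y := lipfree o.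
have n0 i : 0 < `|x' i|.
  rewrite normr_gt0; apply/negP => /eqP x0.
  by have := xx i; rewrite x0 => /esym/eqP; rewrite oner_eq0.
pose phi i (mu : Y) : R^o := `|x' i|^-1 * x' i mu.
have phiop i : op_on [set: Y] 1 (phi i).
  split=> [a u v _ _|u _].
    by rewrite /phi dual_linear mulrDr mulrCA.
  rewrite /phi normrM normfV normr_id ler_pdivrMl// mul1r.
  exact: dual_normP.
have /choice[f fP] i := lipfree_repr (phiop i).
have phix i j : i <> j -> phi i (x j) = 0.
  by move=> ij; rewrite /phi xx0// mulr0.
pose y i : Y := `|x' i| *: x i.
have ysep i j : `|y i - y j| < 1 -> i = j.
  move=> yij; apply: contrapT => ij; move: yij; rewrite ltNge => /negP; apply.
  have := (phiop i).2 (y i - y j) I; rewrite mul1r; apply: le_trans.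
  rewrite (op_onB (phiop i))// /y.
  have lin0 a v : phi i (a *: v) = a *: phi i v.
    by rewrite -[a *: v]addr0 (phiop i).1// (op_on0 lin_setT (phiop i)) addr0.
  rewrite !lin0 (phix i j ij) scaler0 subr0 /phi xx mulr1.
  by rewrite [_ *: _]mulfV ?normr1// gt_eqF.
have ydense mu : clspan (ldelta o @` A) mu.
  have := @lipfree_span _ _ o mu; apply: clspan_sub => _ [z _ <-].
  apply/closure_normP => e e0.
  have [w [/interior_subset zw Aw]] : (ball z e)^° `&` A !=set0.
    by apply: dA; [exists z; exact: nbhsx_ballx|exact: open_interior].
  exists (ldelta o w); first by apply: sub_lin_span; exists w.
  by rewrite (le_lt_trans (ldelta_lip _ _ _))//; move: zw; rewrite ballEmdist.
(* The error is below 1/2, so that two vectors with the same code are at distance less than 1 and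
   therefore equal. *)
have /choice[t tP] i : exists t : seq (rat * (nat -> bool)), exists2 z : seq (rat * Y),
    [seq (p.1, jM (xget o [set w | A w /\ ldelta o w = p.2])) | p <- z] = t /\
    (forall p, p \in z -> (ldelta o @` A) p.2) & `|y i - ratcomb z| < 2^-1.
  have h4 : 0 < 4^-1 :> R by [].
  have [v vA yv] := clspan_approx (ydense (y i)) h4.
  have [z [zA vz]] := ratcomb_approx vA h4.
  eexists; exists z; first by split.
  rewrite (le_lt_trans (ler_distD v _ _))//; lra.
have tinj : injective t.
  move=> i j tij; apply: ysep.
  have [z [zt zA] yz] := tP i; have [z' [zt' zA'] yz'] := tP j.
  have zz' : z = z'.
    (* Decoding works on evaluations rather than points: the point picked for an evaluation need not
       be the original one, but it has the same evaluation. *)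
    pose dec g := ldelta o (xget o [set w | A w /\ jM w = g]).
    have decK (s : seq (rat * Y)) : (forall p, p \in s -> (ldelta o @` A) p.2) ->
        [seq (p.1, dec p.2) | p <-
        [seq (p.1, jM (xget o [set w | A w /\ ldelta o w = p.2])) | p <- s]] = s.
      move=> sA; rewrite -map_comp -[RHS]map_id; apply/eq_in_map => -[r v] /sA /= Av.
      congr pair; have [w0 Aw0 w0v] := Av.
      case: xgetP => [w _ [Aw wv]|/(_ w0)]; last by move=> h; exfalso; apply: h.
      rewrite /dec; case: xgetP => [w1 _ [Aw1 /jMinj]|/(_ w)]; last first.
        by move=> h; exfalso; apply: h.
      by rewrite !inE => /(_ Aw1 Aw) ->.
    by rewrite -(decK z zA) -(decK z' zA') zt zt' tij.
  rewrite -zz' in yz'.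
  have {}yz' : `|ratcomb z - y j| < 2^-1 by rewrite distrC.
  apply: le_lt_trans (ler_distD (ratcomb z) _ _) _.
  by move: yz yz'; lra.
have [code codeinj] := @inj_seq_cantor (nat -> bool) (ex_intro _ id (fun a b h => h)).
pose j i := code (t i).
have jinj : injective j by move=> i i' /codeinj/tinj.
have /choice[u uP] g : exists v : lip0 o,
    (forall i, j i = g -> v = f i) /\ (~ (exists i, j i = g) -> v = 0).
  have [[i ig]|ng] := pselect (exists i, j i = g).
    by exists (f i); split=> [i' i'g|[]]; [congr f; apply: jinj; rewrite ig|exists i].
  by exists 0; split=> // i ig; case: ng; exists i.
have uj i : u (j i) = f i by exact: (uP _).1.
apply: (@wstar_separable_of_c0_family _ _ _ u 1) => //.
- move=> g; have [[i <-]|ng] := pselect (exists i, j i = g).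
    by rewrite uj -[leRHS]normr1; exact: (fP i).1.
  by rewrite (uP g).2// normr0.
- move=> z e e0.
  (* Take a finite combination of basis vectors within e of delta(z). A functional whose index does
     not occur in it kills it, so its value at delta(z) is below e. *)
  have : [set: Y] (ldelta o z) by []; rewrite -xspan => /closure_normP/(_ e e0).
  move=> [_ [n [a [s [sx ->]]]] zs].
  have /choice[l lP] m : exists i, x i = s m by have [i _ <-] := sx m; exists i.
  apply: (sub_finite_set _ (finite_image (j \o l) (@finite_finset _ [set: 'I_n]))).
  move=> g /= eg; have [[i ig]|ng] := pselect (exists i, j i = g); last first.
    by move: eg; rewrite (uP g).2// normr0 leNgt e0.
  move: eg; rewrite -ig uj => eg.
  apply: contrapT => nil; move: eg; apply/negP; rewrite -ltNge.
  have -> : f i z = phi i (ldelta o z) by rewrite -(fP i).2 ldeltaE.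
  have -> : phi i (ldelta o z) = phi i (ldelta o z - \sum_m a m *: s m).
    rewrite (op_onB (phiop i))//.
    rewrite [X in _ - X](_ : _ = 0) ?subr0//.
    have -> : phi i (\sum_m a m *: s m) = \sum_m a m *: phi i (s m).
      by apply: bdd_sumr; exists 1.
    rewrite big1// => m _; rewrite -lP phix ?scaler0// => ilm.
    by apply: nil; exists m => //=; rewrite -ilm.
  by rewrite (le_lt_trans ((phiop i).2 _ I))// mul1r.
- move=> mu muu; apply: xsep => i.
  have : phi i mu = 0 by rewrite -(fP i).2 -uj.
  move=> /eqP; rewrite mulf_eq0 invr_eq0 gt_eqF//= => /eqP ->.
  have [k kb] := dual_bounded (x' i).
  by apply/esym/eqP; rewrite -normr_le0; have := kb 0; rewrite normr0 mulr0.
Qed.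

Theorem corollary5 (R : realType) :
  [/\ forall (M : metricType R) (o : M),
        dens_le M (nat -> bool) ->
        (exists T : {linear lipfree o -> c0 R (nat -> bool)},
          bounded_op T /\ injective T) ->
        separable_set [set: lip0_wstar o],
      forall (M : metricType R) (o : M),
        dens_le M (nat -> bool) ->
        has_markushevich_basis (lipfree o) ->
        separable_set [set: lip0_wstar o]
    & forall X : completeNormedModType R,
        has_projectional_skeleton X ->
        has_markushevich_basis (@lipfree R (metric_of_normed X) 0)].
Proof.
split.
- move=> M o _ [T [Tb Tinj]]; exact: wstar_separable_of_c0_injection Tb Tinj.
- by move=> M o; exact: wstar_separable_of_mbasis.
- by move=> X; exact: lipfree_skeleton_mbasis.
Qed.
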